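(* Let $\operatorname{char}\mathbb{K}=p>0$, let $n\ge 2$ with $p\mid n$, and suppose $\mathcal{E}_{gh}\ne 0$ in $\overline{\mathcal{T}}_n$. Then $\overline{\mathcal{T}}_n(p)=\overline{\mathcal{T}}_n'(p)/(h^p)$ is an $\mathbb{N}$-graded pointed Hopf algebra.
   Context: $\mathbb{K}$ is a field, $\mathbb{N}=\{0,1,2,\ldots\}$, and $[a,b]=ab-ba$. On words in the letters $g,h$ use the lexicographic order with $g\prec h$ (a proper prefix of a word is smaller than the word). A Lyndon word is a nonempty word $\alpha$ which is a single letter or satisfies $\alpha\prec\gamma\beta$ for every factorization $\alpha=\beta\gamma$ into nonempty words. $\alpha(g)$ is the number of occurrences of $g$ in $\alpha$. The standard factorization of a Lyndon word $\alpha$ of length at least $2$ is $\alpha=\beta\gamma$ with $\beta,\gamma$ Lyndon and $\gamma$ of maximal length. Define $E_g=g$, $E_h=h$ and $E_\alpha=[E_\beta,E_\gamma]$ for the standard factorization $\alpha=\beta\gamma$. $\mathcal{T}=\mathbb{K}\langle g,h\rangle$ is the free algebra with bialgebra structure $\Delta(g)=g\otimes g$, $\Delta(h)=1\otimes h+h\otimes g$, $\epsilon(g)=1$, $\epsilon(h)=0$. $\overline{\mathcal{T}}=\mathcal{T}/\mathcal{I}$ is the quotient bialgebra by the ideal generated by all $E_\alpha$ with $\alpha$ Lyndon and $\alpha(g)\ge 2$. $\overline{\mathcal{T}}_n=\overline{\mathcal{T}}/(g^n-1)$, a quotient bialgebra which is a Hopf algebra. For $k\ge 0$, $\omega_k=gh^k$,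 so $E_{\omega_0}=g$, $E_{\omega_1}=E_{gh}=[g,h]$, $E_{\omega_k}=[E_{\omega_{k-1}},h]$; $\mathcal{E}_{\omega_k}$ is the image of $E_{\omega_k}$ in a quotient, $\mathcal{E}_{gh}=\mathcal{E}_{\omega_1}$. $\overline{\mathcal{T}}_n'(p)=\overline{\mathcal{T}}_n/(\mathcal{E}_{\omega_{p-1}})$ (a quotient Hopf algebra), and $\overline{\mathcal{T}}_n(p)$ is the quotient of $\overline{\mathcal{T}}_n'(p)$ by the two-sided ideal generated by $h^p$, with the induced structure. The grading is induced by $\deg g=0$, $\deg h=1$. A Hopf algebra is pointed if its coradical is spanned by grouplike elements. *)

(* Defs.v *)
From HB Require Import structures.
From mathcomp Require Import all_boot all_order all_algebra zify.
From mathcomp Require Import generic_quotient ring_quotient.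
From mathcomp Require Import boolp classical_sets.
From mathcomp Require Import finmap monalg.

Set Implicit Arguments.
Unset Strict Implicit.
Unset Printing Implicit Defensive.

Import GRing.Theory.
Local Open Scope ring_scope.
Local Open Scope quotient_scope.

Reserved Notation "x ⊗ y" (at level 40, left associativity).

Section Span.
Context {K : fieldType} {V : lmodType K}.

Inductive span (S : set V) : set V :=
| span_gen x : S x -> span S x
| span0 : span S 0
| spanD x y : span S x -> span S y -> span S (x + y)
| spanZ (c : K) x : span S x -> span S (c *: x).

Definition subspace (U : set V) : Prop :=
  [/\ U 0, (forall x y, U x -> U y -> U (x + y))
    & (forall (c : K) x, U x -> U (c *: x))].

Definition spanp (S : set V) : {pred V} := fun x => `[< span S x >].

Lemma spanpP (S : set V) x : reflect (span S x) (x \in spanp S).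
Proof. by apply: (iffP idP) => [/asboolP|/asboolP]. Qed.

Lemma spanp_zmod_closed (S : set V) : zmod_closed (spanp S).
Proof.
split=> [|x y]; first exact/spanpP/span0.
move=> /spanpP Sx /spanpP Sy; apply/spanpP/spanD => //.
by rewrite -scaleN1r; apply: spanZ.
Qed.

HB.instance Definition _ (S : set V) :=
  GRing.isZmodClosed.Build V (spanp S) (spanp_zmod_closed S).

End Span.

(* The quotient of V by the subspace spanned by S; its operations are locked
   to keep unification from unfolding them. *)
Definition lquot (K : fieldType) (V : lmodType K) (S : set V) : Type :=
  {ideal_quot (spanp S)}.

HB.instance Definition _ K V S := Choice.on (@lquot K V S).

HB.lock Definition lpi (K : fieldType) (V : lmodType K) (S : set V) (x : V) :
  lquot S := \pi_{ideal_quot (spanp S)} x.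

HB.lock Definition lrepr (K : fieldType) (V : lmodType K) (S : set V)
  (q : lquot S) : V := @repr V {ideal_quot (spanp S)} q.

HB.lock Definition lzero (K : fieldType) (V : lmodType K) (S : set V) :
  lquot S := lpi S 0.

HB.lock Definition ladd (K : fieldType) (V : lmodType K) (S : set V)
  (q r : lquot S) : lquot S := lpi S (lrepr q + lrepr r).

HB.lock Definition lopp (K : fieldType) (V : lmodType K) (S : set V)
  (q : lquot S) : lquot S := lpi S (- lrepr q).

HB.lock Definition lscale (K : fieldType) (V : lmodType K) (S : set V)
  (c : K) (q : lquot S) : lquot S := lpi S (c *: lrepr q).

Section Lquot.
Context {K : fieldType} {V : lmodType K}.
Variable S : set V.
Local Notation lpi := (@lpi K V S).
Local Notation lrepr := (@lrepr K V S).

Lemma lreprK : cancel lrepr lpi.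
Proof. by move=> q; rewrite lpi.unlock lrepr.unlock reprK. Qed.

Lemma lpi_eq x y : lpi x = lpi y <-> span S (x - y).
Proof.
rewrite lpi.unlock; split=> [/eqP|/spanpP h]; first by
  rewrite -Quotient.idealrBE => /spanpP.
by apply/eqP; rewrite -Quotient.idealrBE.
Qed.

Lemma lpiK x : span S (lrepr (lpi x) - x).
Proof. by apply/lpi_eq; rewrite lreprK. Qed.

Lemma ladd_pi x y : ladd (lpi x) (lpi y) = lpi (x + y).
Proof.
rewrite ladd.unlock; apply/lpi_eq; rewrite opprD addrACA.
by apply: spanD; apply: lpiK.
Qed.

Lemma lopp_pi x : lopp (lpi x) = lpi (- x).
Proof.
rewrite lopp.unlock; apply/lpi_eq; rewrite -opprD -[- _]scaleN1r.
by apply/spanZ/lpiK.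
Qed.

Lemma laddA : associative (@ladd K V S).
Proof.
by move=> q r s; rewrite -[q]lreprK -[r]lreprK -[s]lreprK !ladd_pi addrA.
Qed.

Lemma laddC : commutative (@ladd K V S).
Proof. by move=> q r; rewrite -[q]lreprK -[r]lreprK !ladd_pi addrC. Qed.

Lemma ladd0 : left_id (lzero S) (@ladd K V S).
Proof. by move=> q; rewrite -[q]lreprK lzero.unlock ladd_pi add0r. Qed.

Lemma laddN : left_inverse (lzero S) (@lopp K V S) (@ladd K V S).
Proof.
by move=> q; rewrite -[q]lreprK lzero.unlock lopp_pi ladd_pi addNr.
Qed.

HB.instance Definition _ :=
  GRing.isZmodule.Build (lquot S) laddA laddC ladd0 laddN.

Lemma lpiD x y : lpi (x + y) = lpi x + lpi y.
Proof. by rewrite -ladd_pi. Qed.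

Lemma lpiB : {morph lpi : x y / x - y}.
Proof. by move=> x y; rewrite lpiD -lopp_pi. Qed.

HB.instance Definition _ := GRing.isZmodMorphism.Build V (lquot S) lpi lpiB.

Local Notation lscale := (@lscale K V S).

Lemma lscale_pi c x : lscale c (lpi x) = lpi (c *: x).
Proof.
rewrite lscale.unlock; apply/lpi_eq; rewrite -scalerBr.
by apply/spanZ/lpiK.
Qed.

Lemma lscaleA a b q : lscale a (lscale b q) = lscale (a * b) q.
Proof. by rewrite -[q]lreprK !lscale_pi scalerA. Qed.

Lemma lscale1 : left_id 1 lscale.
Proof. by move=> q; rewrite -[q]lreprK lscale_pi scale1r. Qed.

Lemma lscaleDr : right_distributive lscale +%R.
Proof.
move=> a q r; rewrite -[q]lreprK -[r]lreprK -raddfD !lscale_pi.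
by rewrite scalerDr raddfD.
Qed.

Lemma lscaleDl q : {morph lscale^~ q : a b / a + b}.
Proof. by move=> a b; rewrite -[q]lreprK !lscale_pi scalerDl raddfD. Qed.

HB.instance Definition _ := GRing.Zmodule_isLmodule.Build K (lquot S)
  lscaleA lscale1 lscaleDr lscaleDl.

Lemma lpiZ : scalable lpi.
Proof. by move=> c x; rewrite -lscale_pi. Qed.

HB.instance Definition _ := GRing.isScalable.Build K V (lquot S) *:%R lpi lpiZ.

End Lquot.

Section FreeModule.
Context {K : fieldType} {I : choiceType} {V : lmodType K}.

(* The linear extension of f to the K-vector space with basis I. *)
Definition mlin (f : I -> V) (x : {malg K[I]}) : V :=
  \sum_(k <- msupp x) x@_k *: f k.

Lemma mlinEw (f : I -> V) (d : {fset I}) x :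
  (msupp x `<=` d)%fset -> mlin f x = \sum_(k <- d) x@_k *: f k.
Proof.
move=> le; rewrite /mlin; apply: big_fset_incl => // k _ /mcoeff_outdom ->.
by rewrite scale0r.
Qed.

Lemma mlin_is_linear f : linear (mlin f).
Proof.
move=> c x y; pose d := (msupp x `|` msupp y `|` msupp (c *: x + y))%fset.
rewrite !(@mlinEw f d); first last.
- exact: fsubsetUr.
- by apply: fsubset_trans (fsubsetUl _ _); apply: fsubsetUl.
- by apply: fsubset_trans (fsubsetUl _ _); apply: fsubsetUr.
rewrite scaler_sumr -big_split /=; apply: eq_bigr => k _.
by rewrite mcoeffD mcoeffZ scalerDl scalerA.
Qed.

HB.instance Definition _ f :=
  GRing.isLinear.Build K {malg K[I]} V *:%R (mlin f) (mlin_is_linear f).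

Lemma mlinZ (f : I -> V) c x : mlin f (c *: x) = c *: mlin f x.
Proof. by have := mlin_is_linear f c x 0; rewrite raddf0 !addr0. Qed.

Lemma mlinD (f : I -> V) x y : mlin f (x + y) = mlin f x + mlin f y.
Proof. exact: raddfD. Qed.

Lemma mlinU f k : mlin f << k >> = f k.
Proof.
rewrite (@mlinEw f [fset k]%fset); last exact: msuppU_le.
by rewrite big_seq_fset1 mcoeffUU scale1r.
Qed.

End FreeModule.

Lemma malg_spanU (K : fieldType) (I : choiceType) (x : {malg K[I]}) :
  span [set << k >> | k in [set: I]]%classic x.
Proof.
rewrite [x]monalgE; elim/big_rec: _ => [|k y _ h]; first exact: span0.
apply: spanD h; rewrite -[X in << X *g _>>]mulr1.
have -> : << x@_k * 1 *g k >> = x@_k *: << k >>.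
  by apply/malgP => l; rewrite mcoeffZ !mcoeffU mulrnAr.
by apply/spanZ/span_gen; exists k.
Qed.

Inductive tens_rel (K : fieldType) (V W : lmodType K) :
    set {malg K[(V * W)%type]} :=
| tens_relDl v v' w :
    tens_rel (<< (v + v', w) >> - << (v, w) >> - << (v', w) >>)
| tens_relDr v w w' :
    tens_rel (<< (v, w + w') >> - << (v, w) >> - << (v, w') >>)
| tens_relZl (c : K) v w : tens_rel (<< (c *: v, w) >> - c *: << (v, w) >>)
| tens_relZr (c : K) v w : tens_rel (<< (v, c *: w) >> - c *: << (v, w) >>).

Definition tens (K : fieldType) (V W : lmodType K) : Type :=
  lquot (@tens_rel K V W).

HB.instance Definition _ K V W := GRing.Lmodule.on (@tens K V W).

HB.lock Definition tpure (K : fieldType) (V W : lmodType K) (v : V) (w : W) :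
  tens V W := lpi (@tens_rel K V W) << (v, w) >>.

(* The linear map on V ⊗ W induced by f; meaningful when f is bilinear. *)
HB.lock Definition tlift (K : fieldType) (U V W : lmodType K)
  (f : V -> W -> U) (t : tens V W) : U :=
  mlin (fun vw => f vw.1 vw.2) (lrepr t).

Section Tensor.
Context {K : fieldType}.
Implicit Types U V W : lmodType K.

Local Notation "v ⊗ w" := (tpure v w).

Lemma tpure_linearl V W (w : W) : linear (fun v : V => v ⊗ w).
Proof.
move=> c v v'; rewrite tpure.unlock.
have -> : lpi (tens_rel (W:=W)) << (c *: v + v', w) >> =
   lpi (tens_rel (W:=W)) (<< (c *: v, w) >> + << (v', w) >>).
  by apply/lpi_eq/span_gen; rewrite opprD addrA; apply: tens_relDl.
rewrite raddfD -lpiZ; congr (_ + _).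
by apply/lpi_eq/span_gen; apply: tens_relZl.
Qed.

Lemma tpure_linearr V W (v : V) : linear (fun w : W => v ⊗ w).
Proof.
move=> c w w'; rewrite tpure.unlock.
have -> : lpi (tens_rel (W:=W)) << (v, c *: w + w') >> =
   lpi (tens_rel (W:=W)) (<< (v, c *: w) >> + << (v, w') >>).
  by apply/lpi_eq/span_gen; rewrite opprD addrA; apply: tens_relDr.
rewrite raddfD -lpiZ; congr (_ + _).
by apply/lpi_eq/span_gen; apply: tens_relZr.
Qed.

Definition bilin U V W (f : V -> W -> U) : Prop :=
  (forall w, linear (f^~ w)) /\ (forall v, linear (f v)).

Lemma tlift_pi U V W (f : V -> W -> U) (x : {malg K[(V * W)%type]}) :
  bilin f -> tlift f (lpi (tens_rel (W:=W)) x) = mlin (fun vw => f vw.1 vw.2) x.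
Proof.
move=> [fl fr]; set g := mlin _.
have gS y : span (tens_rel (W:=W)) y -> g y = 0.
  elim=> {y} [y h||y z _ gy _ gz|c y _ gy].
  - case: h => [v v' w|v w w'|c v w|c v w]; rewrite /g !raddfB /= ?mlinZ !mlinU /=.
    + by have := fl w 1 v v'; rewrite !scale1r => ->; rewrite -addrA -opprD subrr.
    + by have := fr v 1 w w'; rewrite !scale1r => ->; rewrite -addrA -opprD subrr.
    + have f0 : f 0 w = 0.
        by have := fl w (-1) 0 0; rewrite scaler0 addr0 scaleN1r addNr.
      by have := fl w c v 0; rewrite f0 !addr0 => ->; rewrite subrr.
    + have f0 : f v 0 = 0.
        by have := fr v (-1) 0 0; rewrite scaler0 addr0 scaleN1r addNr.
      by have := fr v c w 0; rewrite f0 !addr0 => ->; rewrite subrr.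
  - by rewrite /g raddf0.
  - by have := mlinD (fun vw => f vw.1 vw.2) y z; rewrite -/g gy gz addr0.
  - by have := mlinZ (fun vw => f vw.1 vw.2) c y; rewrite -/g gy scaler0.
have /lpi_eq/gS : lpi (tens_rel (W:=W)) (lrepr (lpi (tens_rel (W:=W)) x)) =
  lpi (tens_rel (W:=W)) x by rewrite lreprK.
by rewrite tlift.unlock /g raddfB => /eqP; rewrite subr_eq0 => /eqP.
Qed.

Lemma tlift_pure U V W (f : V -> W -> U) v w :
  bilin f -> tlift f (v ⊗ w) = f v w.
Proof. by move=> bf; rewrite tpure.unlock tlift_pi // mlinU. Qed.

Lemma tlift_linear U V W (f : V -> W -> U) : bilin f -> linear (tlift f).
Proof.
move=> bf c s t; rewrite -[s]lreprK -[t]lreprK -linearP !tlift_pi //.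
exact: linearP.
Qed.

Lemma tens_span V W (t : tens V W) : span [set x | exists v w, x = v ⊗ w]%classic t.
Proof.
rewrite -[t]lreprK; elim: (malg_spanU (lrepr t)) => [x [[v w] _ <-]||x y _ ? _ ?|c x _ ?].
- by apply: span_gen; exists v, w; rewrite tpure.unlock.
- by rewrite raddf0; apply: span0.
- by rewrite raddfD; apply: spanD.
- by rewrite lpiZ; apply: spanZ.
Qed.

Lemma tens_ind V W (P : tens V W -> Prop) : (forall v w, P (v ⊗ w)) ->
  P 0 -> (forall s t, P s -> P t -> P (s + t)) ->
  (forall c s, P s -> P (c *: s)) -> forall t, P t.
Proof.
move=> Pp P0 PD PZ t; elim: (tens_span t) => // [x [v [w ->]] //|x y _ ? _ ?|c x _ ?].
- exact: PD.
- exact: PZ.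
Qed.

Lemma eq_linear_tens U V W (f g : tens V W -> U) : linear f -> linear g ->
  (forall v w, f (v ⊗ w) = g (v ⊗ w)) -> f =1 g.
Proof.
move=> fl gl fg.
have l0 (f' : tens V W -> U) : linear f' -> f' 0 = 0.
  by move=> /(_ (-1) 0 0); rewrite scaler0 addr0 scaleN1r addNr.
elim/tens_ind => //.
- by rewrite !l0.
- by move=> s t; have := fl 1 s t; have := gl 1 s t; rewrite !scale1r => -> -> -> ->.
- by move=> c s; have := fl c s 0; have := gl c s 0; rewrite !addr0 !l0 // !addr0 => -> -> ->.
Qed.

Definition tmap V W V' W' (f : V -> V') (g : W -> W') : tens V W -> tens V' W' :=
  tlift (fun v w => f v ⊗ g w).

Definition tassoc U V W : tens (tens U V) W -> tens U (tens V W) :=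
  tlift (fun t w => tlift (fun u v => u ⊗ (v ⊗ w)) t).

End Tensor.

Notation "V ⊗ W" := (tens V W) : type_scope.
Notation "v ⊗ w" := (tpure v w) : ring_scope.

Lemma malg_scalerAr (K : comNzRingType) (M : monomType) (c : K)
  (x y : {malg K[M]}) : c *: (x * y) = x * (c *: y).
Proof.
rewrite (@malgMEw _ _ (msupp x) (msupp y) x (c *: y)) ?msuppZ_le //.
rewrite malgME scaler_sumr; apply: eq_bigr => k _.
rewrite scaler_sumr; apply: eq_bigr => l _; apply/malgP => m.
by rewrite !(mcoeffZ, mcoeffU) mulrnAr mulrCA.
Qed.

(* The free algebra on I, with basis the words in I. Its product is that of
   [malg]; the alias is needed as [malg] comes with an [algType] instance for
   commutative monoids only. *)
Definition freealg (K : fieldType) (I : choiceType) : Type :=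
  {malg K[{fmonom I}]}.

HB.instance Definition _ K I :=
  GRing.Lmodule.copy (freealg K I) {malg K[{fmonom I}]}.

HB.lock Definition fmul (K : fieldType) (I : choiceType)
  (x y : freealg K I) : freealg K I := (x : {malg K[{fmonom I}]}) * y.

Section FreeAlgebra.
Context {K : fieldType} {I : choiceType}.
Local Notation F := (freealg K I).
Local Notation fmul := (@fmul K I).
Local Notation fone := (1 : {malg K[{fmonom I}]}).

Lemma fmulA : associative fmul.
Proof. by rewrite fmul.unlock; exact: mulrA. Qed.
Lemma fmul1r : left_id fone fmul.
Proof. by rewrite fmul.unlock; exact: mul1r. Qed.
Lemma fmulr1 : right_id fone fmul.
Proof. by rewrite fmul.unlock; exact: mulr1. Qed.
Lemma fmulDl : left_distributive fmul +%R.
Proof. by rewrite fmul.unlock; exact: mulrDl. Qed.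
Lemma fmulDr : right_distributive fmul +%R.
Proof. by rewrite fmul.unlock; exact: mulrDr. Qed.
Lemma fone_neq0 : (fone : F) != 0.
Proof. exact: (oner_neq0 {malg K[{fmonom I}]}). Qed.

HB.instance Definition _ := GRing.Zmodule_isNzRing.Build F
  fmulA fmul1r fmulr1 fmulDl fmulDr fone_neq0.

Lemma freealg_scalerAl (c : K) (x y : F) :
  c *: fmul x y = fmul (c *: x : F) y :> F.
Proof. by rewrite fmul.unlock; exact: (@scalerAl K {malg K[{fmonom I}]}). Qed.

HB.instance Definition _ := GRing.Lmodule_isLalgebra.Build K F freealg_scalerAl.

Lemma freealg_scalerAr (c : K) (x y : F) :
  c *: fmul x y = fmul x (c *: y : F) :> F.
Proof. by rewrite fmul.unlock; exact: (@malg_scalerAr K {fmonom I}). Qed.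

HB.instance Definition _ := GRing.Lalgebra_isAlgebra.Build K F freealg_scalerAr.

Definition fword (w : seq I) : freealg K I := << FMonom w >>.

End FreeAlgebra.

Section Ideal.
Context {K : fieldType} {A : algType K}.

Definition ideal (S : set A) : set A :=
  span [set x | exists a s b, S s /\ x = a * s * b]%classic.

Lemma ideal_gen (S : set A) x : S x -> ideal S x.
Proof. by move=> Sx; apply: span_gen; exists 1, x, 1; rewrite mul1r mulr1. Qed.

Lemma ideal_mul (S : set A) a x b : ideal S x -> ideal S (a * x * b).
Proof.
elim=> {x} [x [a' [s [b' [Ss ->]]]]||x y _ hx _ hy|c x _ hx].
- by apply: span_gen; exists (a * a'), s, (b' * b); rewrite !mulrA.
- by rewrite mulr0 mul0r; apply: span0.
- by rewrite mulrDr mulrDl; apply: spanD.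
- by rewrite -scalerAr -scalerAl; apply: spanZ.
Qed.

End Ideal.

(* The quotient algebra A / (S). The properness assumption is there because
   rings of type [algType] satisfy 1 != 0. *)
Definition aquot (K : fieldType) (A : algType K) (S : set A) (properS : ~ ideal S 1) : Type :=
  lquot [set x | exists a s b, S s /\ x = a * s * b]%classic.

HB.lock Definition amul (K : fieldType) (A : algType K) (S : set A)
  (properS : ~ ideal S 1) (q r : aquot properS) : aquot properS :=
  lpi _ (lrepr q * lrepr r).

Section Aquot.
Context {K : fieldType} {A : algType K}.
Variables (S : set A) (properS : ~ ideal S 1).
Local Notation Q := (aquot properS).
Local Notation amul := (@amul K A S properS).

HB.instance Definition _ := GRing.Lmodule.on Q.

Definition api (x : A) : Q := lpi _ x.
Definition arepr (q : Q) : A := lrepr q.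

Lemma areprK : cancel arepr api. Proof. exact: lreprK. Qed.

Lemma api_eq x y : api x = api y <-> ideal S (x - y).
Proof. exact: lpi_eq. Qed.

Lemma api_linear : linear api.
Proof. exact: linearP. Qed.

HB.instance Definition _ := GRing.isLinear.Build K A Q *:%R api api_linear.

Definition aone : Q := api 1.

Lemma amul_pi x y : amul (api x) (api y) = api (x * y).
Proof.
set x' := arepr (api x); set y' := arepr (api y).
have /api_eq hx : api x' = api x by rewrite areprK.
have /api_eq hy : api y' = api y by rewrite areprK.
rewrite amul.unlock; apply/api_eq; rewrite -/x' -/y'.
have -> : x' * y' - x * y = 1 * (x' - x) * y' + x * (y' - y) * 1.
  by rewrite mul1r mulr1 mulrBl mulrBr addrA subrK.
by apply: spanD; apply: ideal_mul.
Qed.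

Lemma amulA : associative amul.
Proof.
by move=> q r s; rewrite -[q]areprK -[r]areprK -[s]areprK !amul_pi mulrA.
Qed.
Lemma amul1r : left_id aone amul.
Proof. by move=> q; rewrite -[q]areprK amul_pi mul1r. Qed.
Lemma amulr1 : right_id aone amul.
Proof. by move=> q; rewrite -[q]areprK amul_pi mulr1. Qed.
Lemma amulDl : left_distributive amul +%R.
Proof.
move=> q r s; rewrite -[q]areprK -[r]areprK -[s]areprK -raddfD !amul_pi.
by rewrite mulrDl raddfD.
Qed.
Lemma amulDr : right_distributive amul +%R.
Proof.
move=> q r s; rewrite -[q]areprK -[r]areprK -[s]areprK -raddfD !amul_pi.
by rewrite mulrDr raddfD.
Qed.
Lemma aone_neq0 : aone != 0.
Proof.
apply/eqP; rewrite /aone -(raddf0 api) => /api_eq.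
by rewrite subr0.
Qed.

HB.instance Definition _ := GRing.Zmodule_isNzRing.Build Q
  amulA amul1r amulr1 amulDl amulDr aone_neq0.

Lemma apiM x y : api (x * y) = api x * api y.
Proof. by rewrite -amul_pi. Qed.

Lemma apiZ (c : K) x : api (c *: x) = c *: api x.
Proof. exact: lpiZ. Qed.

Lemma ascalerAl (c : K) (x y : Q) : c *: (x * y) = (c *: x) * y.
Proof. by rewrite -[x]areprK -[y]areprK -!(apiM, apiZ) scalerAl. Qed.

HB.instance Definition _ := GRing.Lmodule_isLalgebra.Build K Q ascalerAl.

Lemma ascalerAr (c : K) (x y : Q) : c *: (x * y) = x * (c *: y).
Proof. by rewrite -[x]areprK -[y]areprK -!(apiM, apiZ) scalerAr. Qed.

HB.instance Definition _ := GRing.Lalgebra_isAlgebra.Build K Q ascalerAr.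

Lemma api_monoid_morphism : monoid_morphism api.
Proof. by split=> // x y; rewrite apiM. Qed.

HB.instance Definition _ :=
  GRing.isMonoidMorphism.Build A Q api api_monoid_morphism.

End Aquot.

Section Factor.
Context {K : fieldType} {A : algType K}.

Lemma ideal_ker (B : algType K) (f : {lrmorphism A -> B}) (S : set A) x :
  (forall s, S s -> f s = 0) -> ideal S x -> f x = 0.
Proof.
move=> fS; elim=> {x} [x [a [s [b [Ss ->]]]]||x y _ hx _ hy|c x _ hx].
- by rewrite !rmorphM /= (fS s) // mulr0 mul0r.
- exact: raddf0.
- by rewrite raddfD /= hx hy addr0.
- by rewrite linearZ_LR /= hx scaler0.
Qed.

Lemma ideal_proper (B : algType K) (f : {lrmorphism A -> B}) (S : set A) :
  (forall s, S s -> f s = 0) -> ~ ideal S 1.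
Proof.
by move=> fS /(ideal_ker fS); rewrite rmorph1 => /eqP; rewrite oner_eq0.
Qed.

Variables (S : set A) (properS : ~ ideal S 1) (B : algType K).
Variables (f : {lrmorphism A -> B}) (fS : forall s, S s -> f s = 0).

Definition afactor (_ : forall s, S s -> f s = 0) (q : aquot properS) : B :=
  f (arepr q).

Local Notation g := (afactor fS).

Lemma afactor_pi x : g (api properS x) = f x.
Proof.
have /api_eq/(ideal_ker fS) : api properS (arepr (api properS x)) =
  api properS x by rewrite areprK.
by rewrite raddfB => /eqP; rewrite subr_eq0 => /eqP.
Qed.

Lemma afactor_linear : linear g.
Proof.
move=> c q r; rewrite -[q]areprK -[r]areprK -linearP !afactor_pi.
exact: linearP.
Qed.

Lemma afactor_monoid_morphism : monoid_morphism g.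
Proof.
split; first by rewrite [1]/(api properS 1) afactor_pi rmorph1.
move=> q r; rewrite -[q]areprK -[r]areprK -apiM !afactor_pi.
exact: rmorphM.
Qed.

HB.instance Definition _ :=
  GRing.isLinear.Build K (aquot properS) B *:%R g afactor_linear.
HB.instance Definition _ :=
  GRing.isMonoidMorphism.Build (aquot properS) B g afactor_monoid_morphism.

Definition afactor_lrmorphism : {lrmorphism aquot properS -> B} := g.

End Factor.

(* (a ⊗ b) (a' ⊗ b') = (a a') ⊗ (b b') *)
HB.lock Definition tmul (K : fieldType) (A B : algType K) (s t : A ⊗ B) :
  A ⊗ B := tlift (fun a b => tlift (fun a' b' => (a * a') ⊗ (b * b')) t) s.

Section TensorAlgebra.
Context {K : fieldType}.
Variables A B : algType K.
Local Notation tmul := (@tmul K A B).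

Definition tone : A ⊗ B := 1 ⊗ 1.

Lemma linear_0 (U V : lmodType K) (f : U -> V) : linear f -> f 0 = 0.
Proof. by move=> /(_ (-1) 0 0); rewrite scaler0 addr0 scaleN1r addNr. Qed.

Lemma linear_D (U V : lmodType K) (f : U -> V) x y :
  linear f -> f (x + y) = f x + f y.
Proof. by move=> /(_ 1 x y); rewrite !scale1r. Qed.

Lemma linear_Z (U V : lmodType K) (f : U -> V) c x :
  linear f -> f (c *: x) = c *: f x.
Proof. by move=> fl; have := fl c x 0; rewrite (linear_0 fl) !addr0. Qed.

Lemma tmul_bilin_in (a : A) (b : B) :
  bilin (fun a' b' => (a * a') ⊗ (b * b')).
Proof.
split=> [b'|a'] c x y.
  by rewrite mulrDr -scalerAr; apply: tpure_linearl.
by rewrite mulrDr -scalerAr; apply: tpure_linearr.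
Qed.

Lemma tmul_bilin (t : A ⊗ B) :
  bilin (fun a b => tlift (fun a' b' => (a * a') ⊗ (b * b')) t).
Proof.
pose m (a : A) (b : B) := tlift (fun a' b' => (a * a') ⊗ (b * b')).
have ml a b : linear (m a b) by exact: tlift_linear (tmul_bilin_in a b).
have m0 a b : m a b 0 = 0 by exact: linear_0.
have mD a b s u : m a b (s + u) = m a b s + m a b u by exact: linear_D.
have mZ a b c s : m a b (c *: s) = c *: m a b s by exact: linear_Z.
have mp a b a' b' : m a b (a' ⊗ b') = (a * a') ⊗ (b * b').
  by rewrite /m tlift_pure //; apply: tmul_bilin_in.
split=> [b|a] c x y.
  change (m (c *: x + y) b t = c *: m x b t + m y b t).
  elim/(@tens_ind K A B): t => [v w||s t hs ht|d s hs].
  - by rewrite !mp mulrDl -scalerAl; apply: tpure_linearl.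
  - by rewrite !m0 scaler0 addr0.
  - by rewrite !mD hs ht scalerDr addrACA.
  - by rewrite !mZ hs scalerDr !scalerA mulrC.
change (m a (c *: x + y) t = c *: m a x t + m a y t).
elim/(@tens_ind K A B): t => [v w||s t hs ht|d s hs].
- by rewrite !mp mulrDl -scalerAl; apply: tpure_linearr.
- by rewrite !m0 scaler0 addr0.
- by rewrite !mD hs ht scalerDr addrACA.
- by rewrite !mZ hs scalerDr !scalerA mulrC.
Qed.

Lemma tmul_pure (a a' : A) (b b' : B) :
  tmul (a ⊗ b) (a' ⊗ b') = (a * a') ⊗ (b * b').
Proof.
rewrite tmul.unlock tlift_pure; last exact: tmul_bilin.
by rewrite tlift_pure //; apply: tmul_bilin_in.
Qed.

Lemma tmul_linearl t : linear (tmul^~ t).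
Proof. by rewrite tmul.unlock; apply: tlift_linear; apply: tmul_bilin. Qed.

Lemma tmul0l t : tmul 0 t = 0.
Proof. exact: linear_0 (tmul_linearl t). Qed.

Lemma tmulDl : left_distributive tmul +%R.
Proof. by move=> s t u; exact: linear_D (tmul_linearl u). Qed.

Lemma tmulZl c s t : tmul (c *: s) t = c *: tmul s t.
Proof. exact: linear_Z (tmul_linearl t). Qed.

Lemma tmul_linearr s : linear (tmul s).
Proof.
move=> c x y; elim/(@tens_ind K A B): s => [v w||s t hs ht|d s hs].
- have E u : tmul (v ⊗ w) u = tlift (fun a' b' => (v * a') ⊗ (w * b')) u.
    by rewrite tmul.unlock tlift_pure //; apply: tmul_bilin.
  by rewrite !E; apply: (tlift_linear (tmul_bilin_in v w)).
- by rewrite !tmul0l scaler0 addr0.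
- by rewrite !tmulDl hs ht scalerDr addrACA.
- by rewrite !tmulZl hs scalerDr !scalerA mulrC.
Qed.

Lemma tmul0r t : tmul t 0 = 0.
Proof. exact: linear_0 (tmul_linearr t). Qed.

Lemma tmulDr : right_distributive tmul +%R.
Proof. by move=> s t u; exact: linear_D (tmul_linearr s). Qed.

Lemma tmulZr c s t : tmul s (c *: t) = c *: tmul s t.
Proof. exact: linear_Z (tmul_linearr s). Qed.

Lemma tmulA : associative tmul.
Proof.
move=> s t u; elim/(@tens_ind K A B): s => [a b||s s' h h'|c s h];
  rewrite ?(tmul0l, tmulDl, tmulZl) ?h ?h' //.
elim/(@tens_ind K A B): t => [a' b'||t t' h h'|c t h];
  rewrite ?(tmul0l, tmul0r, tmulDl, tmulDr, tmulZl, tmulZr) ?h ?h' //.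
elim/(@tens_ind K A B): u => [a'' b''||u u' h h'|c u h];
  rewrite ?(tmul0r, tmulDr, tmulZr) ?h ?h' //.
by rewrite !tmul_pure !mulrA.
Qed.

Lemma tmul1r : left_id tone tmul.
Proof.
elim/(@tens_ind K A B) => [a b||s t hs ht|c s hs];
  rewrite ?(tmul0r, tmulDr, tmulZr) ?hs ?ht //.
by rewrite tmul_pure !mul1r.
Qed.

Lemma tmulr1 : right_id tone tmul.
Proof.
elim/(@tens_ind K A B) => [a b||s t hs ht|c s hs];
  rewrite ?(tmul0l, tmulDl, tmulZl) ?hs ?ht //.
by rewrite tmul_pure !mulr1.
Qed.

HB.instance Definition _ := GRing.Zmodule_isPzRing.Build (A ⊗ B)%type
  tmulA tmul1r tmulr1 tmulDl tmulDr.

End TensorAlgebra.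

Section FreeAlgebraMaps.
Context {K : fieldType} {I : choiceType}.
Local Notation F := (freealg K I).

Lemma fwordM (v w : seq I) : fword v * fword w = fword (v ++ w) :> F.
Proof.
rewrite /fword -(fmmulE (FMonom v) (FMonom w)); rewrite [LHS](_ : _ = fgmul << FMonom v >> << FMonom w >>).
  by rewrite fgmulUU mul1r.
by rewrite {1}/GRing.mul /= fmul.unlock.
Qed.

Lemma fword1 : 1 = fword [::] :> F.
Proof. by rewrite /fword -fmoneE. Qed.

Lemma fword_ind (P : F -> Prop) : (forall w, P (fword w)) -> P 0 ->
  (forall x y, P x -> P y -> P (x + y)) -> (forall c x, P x -> P (c *: x)) ->
  forall x, P x.
Proof.
move=> Pw P0 PD PZ x; elim: (malg_spanU x) => [y [w _ <-]||y z _ ? _ ?|c y _ ?].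
- by rewrite -[w]fmK; apply: Pw.
- exact: P0.
- exact: PD.
- exact: PZ.
Qed.

Definition fext (V : lmodType K) (f : seq I -> V) (x : F) : V :=
  mlin (fun w : {fmonom I} => f w) x.

Lemma fextD (V : lmodType K) (f : seq I -> V) x y :
  fext f (x + y) = fext f x + fext f y.
Proof. exact: mlinD. Qed.

Lemma fextZ (V : lmodType K) (f : seq I -> V) c x :
  fext f (c *: x) = c *: fext f x.
Proof. exact: mlinZ. Qed.

Lemma fext0 (V : lmodType K) (f : seq I -> V) : fext f 0 = 0.
Proof. by rewrite -(scale0r 0) fextZ scale0r. Qed.

Lemma fextw (V : lmodType K) (f : seq I -> V) w : fext f (fword w) = f w.
Proof. exact: mlinU. Qed.

Lemma fext_linear (V : lmodType K) (f : seq I -> V) : linear (fext f).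
Proof. by move=> c x y; rewrite fextD fextZ. Qed.

Lemma fextM (V : lmodType K) (f : seq I -> V) (m : V -> V -> V) :
  bilin m -> (forall v w, f (v ++ w) = m (f v) (f w)) ->
  forall x y, fext f (x * y) = m (fext f x) (fext f y).
Proof.
move=> [ml mr] fM x y.
elim/fword_ind: x => [v||x x' h h'|c x h].
- elim/fword_ind: y => [w||y y' h h'|c y h].
  + by rewrite fwordM !fextw fM.
  + by rewrite mulr0 !fext0 (linear_0 (mr _)).
  + by rewrite mulrDr !fextD (linear_D _ _ (mr _)) h h'.
  + by rewrite -scalerAr 2!fextZ (linear_Z _ _ (mr _)) h.
- by rewrite mul0r !fext0 (linear_0 (ml _)).
- by rewrite mulrDl !fextD (linear_D _ _ (ml _)) h h'.
- by rewrite -scalerAl 2!fextZ (linear_Z _ _ (ml _)) h.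
Qed.

(* The algebra morphism sending each letter i to f i. *)
Definition flift (A : algType K) (f : I -> A) : F -> A :=
  fext (fun w => \prod_(i <- w) f i).

Lemma flift_monoid_morphism (A : algType K) (f : I -> A) :
  monoid_morphism (flift f).
Proof.
split; first by rewrite /flift fword1 fextw big_nil.
apply: fextM => [|v w]; last exact: big_cat.
by split=> a c x y; [rewrite mulrDl -scalerAl | rewrite mulrDr -scalerAr].
Qed.

HB.instance Definition _ (A : algType K) (f : I -> A) :=
  GRing.isLinear.Build K F A *:%R (flift f) (fext_linear _).
HB.instance Definition _ (A : algType K) (f : I -> A) :=
  GRing.isMonoidMorphism.Build F A (flift f) (flift_monoid_morphism f).

End FreeAlgebraMaps.

Section Coalgebra.
Context {K : fieldType} {C : lmodType K}.
Variables (Delta : C -> C ⊗ C) (eps : C -> K).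

Record is_coalgebra : Prop := IsCoalgebra {
  comul_linear : linear Delta;
  counit_scalar : scalar eps;
  comulA : forall x,
    tassoc (tmap Delta idfun (Delta x)) = tmap idfun Delta (Delta x);
  comul_counitl : forall x, tlift (fun a b => eps a *: b) (Delta x) = x;
  comul_counitr : forall x, tlift (fun a b => eps b *: a) (Delta x) = x
}.

Definition grouplike (x : C) : Prop := Delta x = x ⊗ x /\ eps x = 1.

(* K being a field, D ⊗ D is the subspace of C ⊗ C spanned by the a ⊗ b. *)
Definition subcoalgebra (D : set C) : Prop :=
  subspace D /\
  forall x, D x ->
    span [set t | exists a b, [/\ D a, D b & t = a ⊗ b]]%classic (Delta x).

Definition simple_subcoalgebra (D : set C) : Prop :=
  [/\ subcoalgebra D, D <> [set 0]%classic
    & forall E, subcoalgebra E -> (E `<=` D)%classic ->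
        E = [set 0]%classic \/ E = D].

(* The coradical: the sum of the simple subcoalgebras. *)
Definition coradical : set C :=
  span [set x | exists2 D, simple_subcoalgebra D & D x]%classic.

Definition pointed : Prop := coradical = span grouplike.

End Coalgebra.

Section Hopf.
Context {K : fieldType} {H : algType K}.
Variables (Delta : H -> H ⊗ H) (eps : H -> K) (S : H -> H).

Record is_bialgebra : Prop := IsBialgebra {
  bialgebra_coalgebra : is_coalgebra Delta eps;
  comul_monoid_morphism : monoid_morphism Delta;
  counit_monoid_morphism : monoid_morphism eps
}.

Record is_hopf_algebra : Prop := IsHopfAlgebra {
  hopf_bialgebra : is_bialgebra;
  antipode_linear : linear S;
  antipodel : forall x, tlift (fun a b => S a * b) (Delta x) = eps x *: 1;
  antipoder : forall x, tlift (fun a b => a * S b) (Delta x) = eps x *: 1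
}.

Variable D : nat -> set H.

(* H is the direct sum of the subspaces D d. *)
Record is_grading : Prop := IsGrading {
  grading_subspace : forall d, subspace (D d);
  grading_sum : forall x, exists (m : nat) (c : nat -> H),
    (forall d, D d (c d)) /\ x = \sum_(d < m) c d;
  grading_direct : forall (m : nat) (c : nat -> H), (forall d, D d (c d)) ->
    \sum_(d < m) c d = 0 -> forall d, (d < m)%N -> c d = 0
}.

Record is_graded_hopf_algebra : Prop := IsGradedHopfAlgebra {
  graded_hopf : is_hopf_algebra;
  graded_grading : is_grading;
  graded_1 : D 0%N 1;
  graded_mul : forall i j x y, D i x -> D j y -> D (i + j)%N (x * y);
  graded_comul : forall d x, D d x ->
    span [set t | exists i j a b,
      [/\ (i + j)%N = d, D i a, D j b & t = a ⊗ b]]%classic (Delta x);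
  graded_counit : forall d x, D d x -> d != 0%N -> eps x = 0;
  graded_antipode : forall d x, D d x -> D d (S x)
}.

End Hopf.

Local Open Scope nat_scope.

(* Letters are booleans, with g = false and h = true, so that g < h. *)
Definition word := seq bool.
Definition lg : bool := false.
Definition lh : bool := true.

(* The lexicographic order; a proper prefix of a word is smaller than it. *)
Definition word_lt (v w : word) : bool :=
  ((v : Order.SeqLexiOrder.type_ bool) < w)%O.

Definition lyndon (w : word) : bool :=
  (w != [::]) &&
  all (fun i => word_lt w (drop i w ++ take i w)) (iota 1 (size w).-1).

(* The standard factorization of w is (take i w, drop i w) for this i: the
   least cut into two Lyndon words makes the right factor longest. *)
Definition std_cut (w : word) : nat :=
  (find (fun i => lyndon (take i w) && lyndon (drop i w))
        (iota 1 (size w).-1)).+1.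

Lemma lyndonP (w : word) : reflect
  (w <> [::] /\ (size w = 1 \/ forall u v, u <> [::] -> v <> [::] ->
     w = u ++ v -> word_lt w (v ++ u)))
  (lyndon w).
Proof.
apply: (iffP andP) => [[/eqP w0 /allP hw]|[/eqP w0 hw]].
- split=> //; right=> u v u0 v0 E; subst w.
  have := hw (size u); rewrite mem_iota drop_size_cat // take_size_cat //.
  apply; rewrite size_cat; case: u u0 {hw w0} => // a u' _.
  by case: v v0 => // b v' _ /=; lia.
- split=> //; apply/allP => i; rewrite mem_iota add1n => /andP[i0 iw].
  case: hw => [w1|hw]; first by move: iw; rewrite w1 /= leqNgt ltnS i0.
  have iw' : i < size w by case: (w) w0 iw => //= a w' _; rewrite ltnS.
  apply: hw; last by rewrite cat_take_drop.
  + by move/(congr1 size); rewrite size_take iw' /=; case: (i) i0.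
  + by move/(congr1 size)/eqP; rewrite size_drop subn_eq0 leqNgt iw'.
Qed.

Section LyndonBracket.
Variables (R : nzRingType) (g h : R).

Definition comm (x y : R) : R := (x * y - y * x)%R.

(* The iterated bracket E_w of a Lyndon word w; k bounds the recursion depth,
   and the value on words that are not Lyndon is irrelevant. *)
Fixpoint Ebr_rec (k : nat) (w : word) : R :=
  if k is k'.+1 then
    if w is [:: a] then if a == lh then h else g
    else comm (Ebr_rec k' (take (std_cut w) w)) (Ebr_rec k' (drop (std_cut w) w))
  else 0%R.

Definition Ebr (w : word) : R := Ebr_rec (size w) w.

Lemma Ebr_g : Ebr [:: lg] = g. Proof. by []. Qed.
Lemma Ebr_h : Ebr [:: lh] = h. Proof. by []. Qed.

Lemma Ebr_recS k w : 1 < size w ->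
  Ebr_rec k.+1 w = comm (Ebr_rec k (take (std_cut w) w))
                      (Ebr_rec k (drop (std_cut w) w)).
Proof. by case: w => [|a [|b w]]. Qed.

Lemma Ebr_rec0 k : Ebr_rec k [::] = 0%R.
Proof. by case: k => //= k; rewrite /comm subrr. Qed.

Lemma Ebr_rec_fuel k l w : size w <= k -> size w <= l -> Ebr_rec k w = Ebr_rec l w.
Proof.
elim: k l w => [|k IH] [|l] w.
- by [].
- by rewrite leqn0 => /nilP ->; rewrite !Ebr_rec0.
- by move=> _; rewrite leqn0 => /nilP ->; rewrite !Ebr_rec0.
case: w => [|a [|b w]]; rewrite ?Ebr_rec0 // => hk hl.
rewrite /Ebr_rec -/Ebr_rec; set w' := a :: b :: w in hk hl *.
have [c|c] := ltnP (std_cut w') (size w').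
  have c0 : 0 < std_cut w' by [].
  congr comm; apply: IH; rewrite ?size_take ?size_drop ?c.
  1,2: by rewrite -ltnS (leq_trans c).
  1,2: by rewrite -ltnS (leq_trans _ hk, leq_trans _ hl) // ltn_subrL c0.
by rewrite (drop_oversize c) !Ebr_rec0 /comm !mulr0 !mul0r.
Qed.

Lemma Ebr_std (u v : word) : lyndon (u ++ v) -> lyndon u -> lyndon v ->
  (forall u' v', u' ++ v' = u ++ v -> lyndon u' -> lyndon v' ->
     size v' <= size v) ->
  Ebr (u ++ v) = comm (Ebr u) (Ebr v).
Proof.
move=> _ lu lv hmax; set w := u ++ v.
have u0 : 0 < size u by rewrite lt0n size_eq0; case/andP: lu.
have v0 : 0 < size v by rewrite lt0n size_eq0; case/andP: lv.
have cE : std_cut w = size u.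
  rewrite /std_cut; set p := (fun i => _); set s := iota _ _.
  have uE : nth 0%N s (size u).-1 = size u.
    by rewrite nth_iota ?size_cat; lia.
  have ps : p (size u).
    by rewrite /p take_size_cat // drop_size_cat // lu lv.
  have szs : size s = (size w).-1 by rewrite size_iota.
  have hs : has p s.
    apply/hasP; exists (size u) => //; rewrite mem_iota size_cat; lia.
  have lt : find p s < size s by rewrite -has_find.
  have pf := nth_find 0%N hs; move: pf; rewrite nth_iota -?szs //.
  set i := (1 + find p s)%N => /andP[l1 l2].
  have := hmax _ _ (cat_take_drop i w) l1 l2.
  rewrite size_drop size_cat => le1.
  have le2 : find p s <= (size u).-1.
    rewrite leqNgt; apply/negP => /(before_find 0%N).
    by rewrite uE ps.
  by rewrite /i in le1; lia.
have sw : 1 < size w by rewrite size_cat; lia.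
have -> : Ebr w = comm (Ebr_rec (size w).-1 u) (Ebr_rec (size w).-1 v).
  rewrite {1}/Ebr -[in LHS](ltn_predK sw) Ebr_recS // cE.
  by rewrite take_size_cat // drop_size_cat.
by congr comm; apply: Ebr_rec_fuel; rewrite ?size_cat; lia.
Qed.

Lemma Ebr_comm (w : word) : 1 < size w -> exists x y, Ebr w = comm x y.
Proof.
by move=> sw; rewrite /Ebr -(ltn_predK sw) Ebr_recS //; eexists; eexists.
Qed.

End LyndonBracket.

Local Close Scope nat_scope.

(* ω_k = g h^k *)
Definition omega (k : nat) : word := lg :: nseq k lh.

Section Algebras.
Variable K : fieldType.

(* The bialgebra K<g, h> *)
Definition Tfree : algType K := freealg K bool.

Definition Tg : Tfree := fword [:: lg].
Definition Th : Tfree := fword [:: lh].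

(* The algebra morphism with g |-> g ⊗ g and h |-> 1 ⊗ h + h ⊗ g *)
Definition TDelta : Tfree -> Tfree ⊗ Tfree :=
  fext (fun w =>
    \prod_(a <- w) (if a == lh then 1 ⊗ Th + Th ⊗ Tg else Tg ⊗ Tg)).

(* The algebra morphism with g |-> 1 and h |-> 0 *)
Definition Teps : {lrmorphism Tfree -> K^o} :=
  flift (fun a => if a == lh then 0 else 1).

(* The grading with deg g = 0 and deg h = 1 *)
Definition Tdeg (d : nat) : set Tfree :=
  span [set x | exists2 w, count_mem lh w = d & x = fword w]%classic.

Lemma TDelta_g : TDelta Tg = Tg ⊗ Tg.
Proof. by rewrite /TDelta fextw big_seq1. Qed.

Lemma TDelta_h : TDelta Th = 1 ⊗ Th + Th ⊗ Tg.
Proof. by rewrite /TDelta fextw big_seq1. Qed.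

Lemma TDelta_linear : linear TDelta.
Proof. exact: fext_linear. Qed.

Lemma TDelta_monoid_morphism : monoid_morphism TDelta.
Proof.
split; first by rewrite /TDelta fword1 fextw big_nil.
apply: fextM => [|v w]; last exact: big_cat.
by split; [exact: tmul_linearl | exact: tmul_linearr].
Qed.

Lemma Teps_g : Teps Tg = 1.
Proof. by rewrite /= /flift fextw big_seq1. Qed.

Lemma Teps_h : Teps Th = 0.
Proof. by rewrite /= /flift fextw big_seq1. Qed.

Lemma lrmorph_comm (A : algType K) (f : {lrmorphism A -> K^o}) (x y : A) :
  f (comm x y) = 0.
Proof. by rewrite /comm rmorphB !rmorphM /= mulrC subrr. Qed.

Lemma Teps_Ebr w : (1 < size w)%N -> Teps (Ebr Tg Th w) = 0.
Proof. by case/(Ebr_comm Tg Th) => x [y ->]; exact: lrmorph_comm. Qed.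

Definition Tbar_rel : set Tfree :=
  [set x | exists w, [/\ lyndon w, (2 <= count_mem lg w)%N
                        & x = Ebr Tg Th w]]%classic.

Lemma Tbar_relP x : Tbar_rel x -> Teps x = 0.
Proof.
move=> [w [_ gw ->]]; apply: Teps_Ebr.
exact: leq_trans gw (count_size _ _).
Qed.

Lemma Tbar_proper : ~ ideal Tbar_rel 1.
Proof. exact: ideal_proper Tbar_relP. Qed.

Definition Tbar : algType K := aquot Tbar_proper.
Definition pi_bar : {lrmorphism Tfree -> Tbar} := api Tbar_proper.

Definition Tbar_eps : {lrmorphism Tbar -> K^o} :=
  afactor_lrmorphism Tbar_proper Tbar_relP.

Lemma Tbar_epsE x : Tbar_eps (pi_bar x) = Teps x.
Proof. exact: afactor_pi. Qed.

Section Order.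
Variable n : nat.

Definition Tbarn_rel : set Tbar := [set pi_bar Tg ^+ n - 1]%classic.

Lemma Tbarn_relP x : Tbarn_rel x -> Tbar_eps x = 0.
Proof.
move=> ->; have e : Tbar_eps (pi_bar Tg ^+ n) = Tbar_eps (pi_bar Tg) ^+ n.
  exact: rmorphXn.
apply: etrans (raddfB Tbar_eps _ _) _; apply/eqP; rewrite subr_eq0; apply/eqP.
apply: etrans e _; rewrite Tbar_epsE Teps_g expr1n; exact/esym/rmorph1.
Qed.

Lemma Tbarn_proper : ~ ideal Tbarn_rel 1.
Proof. exact: ideal_proper Tbarn_relP. Qed.

Definition Tbarn : algType K := aquot Tbarn_proper.
Definition pi_n : {lrmorphism Tbar -> Tbarn} := api Tbarn_proper.

Definition Tbarn_eps : {lrmorphism Tbarn -> K^o} :=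
  afactor_lrmorphism Tbarn_proper Tbarn_relP.

Lemma Tbarn_epsE x : Tbarn_eps (pi_n x) = Tbar_eps x.
Proof. exact: afactor_pi. Qed.

Definition Eomega (k : nat) : Tbarn := pi_n (pi_bar (Ebr Tg Th (omega k))).

Section Char.
Variables (p : nat) (charK : p \in [pchar K]).

Definition Tbarnp'_rel : set Tbarn := [set Eomega p.-1]%classic.

Lemma Tbarnp'_relP x : Tbarnp'_rel x -> Tbarn_eps x = 0.
Proof.
move=> ->; rewrite /Eomega Tbarn_epsE Tbar_epsE Teps_Ebr //.
by rewrite /= size_nseq; have := prime_gt1 (pcharf_prime charK); case: (p).
Qed.

Lemma Tbarnp'_proper : ~ ideal Tbarnp'_rel 1.
Proof. exact: ideal_proper Tbarnp'_relP. Qed.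

Definition Tbarnp' : algType K := aquot Tbarnp'_proper.
Definition pi_np' : {lrmorphism Tbarn -> Tbarnp'} := api Tbarnp'_proper.

Definition Tbarnp'_eps : {lrmorphism Tbarnp' -> K^o} :=
  afactor_lrmorphism Tbarnp'_proper Tbarnp'_relP.

Lemma Tbarnp'_epsE x : Tbarnp'_eps (pi_np' x) = Tbarn_eps x.
Proof. exact: afactor_pi. Qed.

Definition Tbarnp_rel : set Tbarnp' :=
  [set pi_np' (pi_n (pi_bar Th)) ^+ p]%classic.

Lemma Tbarnp_relP x : Tbarnp_rel x -> Tbarnp'_eps x = 0.
Proof.
move=> ->; set y := pi_np' _.
have -> : Tbarnp'_eps (y ^+ p) = Tbarnp'_eps y ^+ p by exact: rmorphXn.
rewrite Tbarnp'_epsE Tbarn_epsE Tbar_epsE Teps_h.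
by rewrite expr0n gtn_eqF // prime_gt0 // (pcharf_prime charK).
Qed.

Lemma Tbarnp_proper : ~ ideal Tbarnp_rel 1.
Proof. exact: ideal_proper Tbarnp_relP. Qed.

Definition Tbarnp : algType K := aquot Tbarnp_proper.

Definition proj (x : Tfree) : Tbarnp :=
  api Tbarnp_proper (pi_np' (pi_n (pi_bar x))).

Definition Tbarnp_deg (d : nat) : set Tbarnp :=
  [set proj x | x in Tdeg d]%classic.

End Char.
End Order.
End Algebras.

Arguments proj {K} n {p} charK x.
Arguments Tbarnp_deg {K} n {p} charK d.

(* Main.v *)
From HB Require Import structures.
From mathcomp Require Import all_boot all_order all_algebra.
From mathcomp Require Import boolp classical_sets.
From mathcomp Require Import zify.
Require Import Defs.

Set Implicit Arguments.
Unset Strict Implicit.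
Unset Printing Implicit Defensive.

Import GRing.Theory.
Local Open Scope ring_scope.

(** Write [w_k] for the class of [E_(g h^k)], so that [w_0 = g] and
    [w_(k+1) = w_k h - h w_k], that is [w_k = iter k (rad h) g].

    A Lyndon word with two letters [g] is [g h^i g h^j] with [i < j], and its
    bracket is the commutator of [w_i] and [w_j]; the bracket of a Lyndon word
    with more letters [g] lies in the ideal generated by these commutators.
    Hence the quotient algebra [H] is presented by: the [w_k] commute, [g^n = 1],
    [w_(p-1) = 0] and [h^p = 0].

    What has to be seen is that the coproduct and the antipode respect these
    relations. The commutation relations are preserved because bracketing with
    [Delta h = 1 ⊗ h + h ⊗ g] preserves [A ⊗ A], where [A] is the commutative
    subalgebra generated by the [w_k] ([qDelta_W_comm]); likewise the antipode
    maps [w_k] into [A] ([wsub_Tanti_W]). For the two other relations the tool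
    is Hochschild's formula in characteristic [p]: if [y] commutes with all
    [y_k = (ad x)^k y], then [(x + y)^p = x^p + y^p + y_(p-1)] ([hochschild]).
    With [x = 1 ⊗ h] and [y = h ⊗ g] it gives
      [Delta (h^p) = 1 ⊗ h^p + h^p ⊗ g^p + h ⊗ w_(p-1)],
    and its polarization, in which [y] is replaced by [y + t z] and coefficients
    of [t] are compared, gives for [z = g ⊗ g]
      [Delta (w_(p-1)) = g ⊗ w_(p-1) + w_(p-1) ⊗ g^p].
    Both computations are carried out in [T ⊗ H], [T] being the free algebra
    ([hDelta_hXp], [hDelta_W_last]): only the second tensor factor
    needs the relations. From there the map [T ⊗ H -> H ⊗ H] shows that [Delta]
    descends, and the map [a ⊗ b |-> S(a) b], which sends [Delta x] to
    [eps x], shows that [S(h^p) g^p = 0] and [S(w_(p-1)) g^p = 0], so that the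
    antipode descends as well. No formula for [S(w_(p-1))] is needed.

    The bialgebra and antipode identities then hold on all of [H] because they
    are stable under left multiplication by [g] and by [h]. The grading exists
    since all relations are homogeneous. Finally a graded coalgebra whose
    degree 0 part is spanned by grouplike elements is pointed
    ([pointed_of_deg0_grouplike]), and here the degree 0 part is spanned by the
    powers of [g]. *)

(** * Hochschild's formula in characteristic p *)

Definition rad (R : pzRingType) (x y : R) : R := y * x - x * y.

(** By Pascal's rule consecutive binomials [C(p-1, i)] and [C(p-1, i+1)] add up
    to [C(p, i+1)], which vanishes modulo [p]; so they alternate in sign. *)
Lemma bin_pred_prime (R : pzRingType) (p i : nat) : prime p ->
  p%:R = 0 :> R -> (i < p)%N -> (-1) ^+ i * 'C(p.-1, i)%:R = 1 :> R.
Proof.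
move=> pp pR; elim: i => [|i IH] ip; first by rewrite bin0 mulr1.
have p0 := prime_gt0 pp.
have := prime_dvd_bin pp (k := i.+1); rewrite ip => /(_ isT) /dvdnP[m E].
have E' : 'C(p.-1, i.+1)%:R + 'C(p.-1, i)%:R = 0 :> R.
  by rewrite -natrD -binS prednK // E natrM pR mulr0.
rewrite exprS mulN1r mulNr (_ : 'C(p.-1, i.+1)%:R = - 'C(p.-1, i)%:R); last first.
  by apply/eqP; rewrite -addr_eq0 E'.
by rewrite mulrN opprK IH // ltnW.
Qed.

(** Right and left multiplication by [x] commute, so this is the binomial
    theorem for a power of their difference. *)
Lemma iter_radE (R : pzRingType) (x y : R) m :
  iter m (rad x) y = \sum_(i < m.+1)
    (-1) ^+ i * 'C(m, i)%:R * (x ^+ i * y * x ^+ (m - i)).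
Proof.
elim: m => [|m IH]; first by rewrite big_ord1 /= !mul1r mulr1.
pose F i := (-1) ^+ i * 'C(m, i)%:R * (x ^+ i * y * x ^+ (m.+1 - i)) : R.
pose G i := (-1) ^+ i.+1 * 'C(m, i)%:R * (x ^+ i.+1 * y * x ^+ (m - i)) : R.
have Cc i (a : R) : x * ((-1) ^+ i * a) = (-1) ^+ i * (x * a).
  by rewrite !mulrA (commr_sign x i : x * _ = _).
have Cn k (a : R) : x * (k%:R * a) = k%:R * (x * a).
  by rewrite !mulrA (commr_nat x k : x * _ = _).
have EF : iter m (rad x) y * x = \sum_(i < m.+2) F i.
  rewrite IH [RHS]big_ord_recr /= {2}/F bin_small // mulr0 mul0r addr0 mulr_suml.
  apply: eq_bigr => i _; rewrite /F -!mulrA -exprSr subSn // -ltnS; exact: ltn_ord.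
have EG : x * iter m (rad x) y = - \sum_(i < m.+1) G i.
  rewrite IH mulr_sumr -sumrN; apply: eq_bigr => i _.
  by rewrite /G exprS mulN1r !mulNr opprK -!mulrA Cc Cn exprS !mulrA.
rewrite iterS {1}/rad EF EG opprK big_ord_recl [RHS]big_ord_recl -addrA.
congr (_ + _); first by rewrite /F !bin0.
rewrite -big_split; apply: eq_bigr => i _ /=.
by rewrite /F /G /bump /= !add1n subSS -mulrDl -mulrDr -natrD binS.
Qed.

Section HochschildChar.
Variables (p : nat).
Hypothesis p_pr : prime p.

Lemma iter_rad_prime (R : pzRingType) (x y : R) : p%:R = 0 :> R ->
  iter p.-1 (rad x) y = \sum_(i < p) x ^+ i * y * x ^+ (p.-1 - i).
Proof.
move=> pR; rewrite iter_radE prednK ?prime_gt0 //; apply: eq_bigr => i _.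
by rewrite bin_pred_prime // mul1r.
Qed.

Lemma mulrn_prime_eq0 (R : pzRingType) (a : R) i : p%:R = 0 :> R ->
  (0 < i < p)%N -> a *+ i = 0 -> a = 0.
Proof.
move=> pR /andP[i0 ip] ai.
have co : coprime i p.
  by rewrite coprime_sym prime_coprime // gtnNdvd.
case: (egcdnP p i0) => km kn E _; move: E; rewrite (eqP co) => E.
have : a *+ (km * i) = a *+ (kn * p + 1) by rewrite E.
rewrite mulrnDr mulr1n [(km * i)%N]mulnC [(kn * p)%N]mulnC !mulrnA ai mul0rn.
by rewrite -[a *+ p]mulr_natr pR mulr0 mul0rn add0r.
Qed.

(** The powers of the line [t |-> a + b t], as polynomials over a ring that need
    not be commutative; the variable is central. *)
Section Line.
Variables (R : nzRingType) (a b : R).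
Let q : {poly R} := a%:P + b%:P * 'X.

Lemma deriv_line_exp m :
  (q ^+ m)^`() = \sum_(i < m) q ^+ i * b%:P * q ^+ (m.-1 - i).
Proof.
have dq : q^`() = b%:P.
  by rewrite /q derivD derivC add0r derivM derivC mul0r add0r derivX mulr1.
elim: m => [|m IH]; first by rewrite expr0 derivC big_ord0.
rewrite exprSr derivM dq IH big_ord_recr /= subnn expr0 mulr1; congr (_ + _).
rewrite mulr_suml; apply: eq_bigr => i _; rewrite -!mulrA -exprSr.
by case: m i {IH} => [[]//|m i] /=; rewrite subSn // -ltnS.
Qed.

Lemma coef0_line_exp m : (q ^+ m)`_0 = a ^+ m.
Proof.
elim: m => [|m IH]; first by rewrite !expr0 coef1.
by rewrite !exprS coef0M IH /q coefD coefMX !coefC eqxx addr0.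
Qed.

Lemma coef1_line_exp m :
  (q ^+ m)`_1 = \sum_(i < m) a ^+ i * b * a ^+ (m.-1 - i).
Proof.
have -> : (q ^+ m)`_1 = (q ^+ m)^`()`_0 by rewrite coef_deriv.
rewrite deriv_line_exp coef_sum; apply: eq_bigr => i _.
by rewrite !coef0M !coef0_line_exp coefC.
Qed.

Lemma coef_line_exp_top m : (size (q ^+ m) <= m.+1)%N /\ (q ^+ m)`_m = b ^+ m.
Proof.
elim: m => [|m [sm cm]]; first by rewrite !expr0 size_poly1 coef1.
have E : q ^+ m.+1 = q ^+ m * a%:P + q ^+ m * b%:P * 'X.
  by rewrite exprSr mulrDr mulrA.
split; last first.
  by rewrite E coefD coefMX /= !coefMC cm nth_default // mul0r add0r exprSr.
apply/leq_sizeP => j mj; rewrite E coefD coefMX !coefMC.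
have jm : (m < j)%N by exact: ltnW.
rewrite nth_default ?(leq_trans sm) // mul0r add0r; case: j mj {jm} => // j mj.
by rewrite /= nth_default ?mul0r // (leq_trans sm).
Qed.

Lemma line_exp_at1 m : (a + b) ^+ m = \sum_(i < m.+1) (q ^+ m)`_i.
Proof.
have e1 (r : {poly R}) : comm_poly r 1 by rewrite /comm_poly mulr1 mul1r.
have -> : a + b = q.[1].
  by rewrite /q hornerD hornerMX !hornerC mulr1.
rewrite -horner_exp_comm; last exact: e1.
rewrite (@horner_coef_wide _ m.+1) ?(proj1 (coef_line_exp_top m)) //.
by apply: eq_bigr => i _; rewrite expr1n mulr1.
Qed.

End Line.

(** The derivative in [t] of [(x + y t)^p] is the sum of the
    [(x + y t)^i y (x + y t)^(p-1-i)], i.e. the iterated bracket of [y] with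
    [x + y t], which is the constant [y_(p-1)] as [y] commutes with all [y_k]. So
    the coefficients of [t^i] with [1 < i < p] vanish, that of [t] is [y_(p-1)],
    and [t = 1] gives the formula. *)
Lemma hochschild_nz (R : nzRingType) (x y : R) : p%:R = 0 :> R ->
  (forall k, y * iter k (rad x) y = iter k (rad x) y * y) ->
  (x + y) ^+ p = x ^+ p + y ^+ p + iter p.-1 (rad x) y.
Proof.
move=> pR cy; pose q : {poly R} := x%:P + y%:P * 'X.
have pP : p%:R = 0 :> {poly R} by rewrite -[p%:R]polyC_natr pR polyC0.
have radq k : iter k (rad q) y%:P = (iter k (rad x) y)%:P.
  elim: k => //= k ->; set u := iter k _ _.
  rewrite /rad /q mulrDr mulrDl opprD addrACA !polyCB !polyCM.
  rewrite -[y%:P * 'X * _]mulrA -commr_polyX !mulrA -mulrBl -!polyCM.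
  by rewrite cy subrr mul0r addr0.
have dq : (q ^+ p)^`() = (iter p.-1 (rad x) y)%:P.
  by rewrite -radq iter_rad_prime // /q deriv_line_exp.
(* i times the i-th coefficient is a coefficient of the constant derivative. *)
have c0 i : (1 < i < p)%N -> (q ^+ p)`_i = 0.
  move=> /andP[i1 ip]; apply: (mulrn_prime_eq0 pR (i := i)).
    by rewrite ip (ltnW i1).
  case: i i1 ip => // i i1 _; rewrite -coef_deriv dq coefC.
  by case: i i1.
have c1 : (q ^+ p)`_1 = iter p.-1 (rad x) y.
  by rewrite -[LHS]mulr1n -coef_deriv dq coefC.
rewrite (line_exp_at1 x y) -/q.
have := prime_gt1 p_pr; case: p c0 c1 (coef_line_exp_top x y p) => [|[|m]] // c0 c1.
rewrite -/q => -[_ cp] _; rewrite big_ord_recr /= cp big_ord_recl coef0_line_exp.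
rewrite big_ord_recl c1 big1 ?addr0; last by move=> i _; apply: c0; rewrite !ltnS ltn_ord.
by rewrite addrAC.
Qed.

(** This compares the coefficients of [t] in Hochschild's formula for [x] and
    [y + t z]; the hypotheses say that [y + t z] commutes with its iterated
    brackets. The coefficient of [t] in a [p]-th power [(a + t b)^p] is again an
    iterated bracket, by [iter_rad_prime]. *)
Lemma hochschild_polarized_nz (R : nzRingType) (x y z : R) : p%:R = 0 :> R ->
  (forall k, y * iter k (rad x) y = iter k (rad x) y * y) ->
  (forall k, z * iter k (rad x) z = iter k (rad x) z * z) ->
  (forall k, y * iter k (rad x) z + z * iter k (rad x) y
           = iter k (rad x) z * y + iter k (rad x) y * z) ->
  iter p.-1 (rad (x + y)) z = iter p.-1 (rad y) z + iter p.-1 (rad x) z.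
Proof.
move=> pR cy cz cyz; pose Y : {poly R} := y%:P + z%:P * 'X.
have pP : p%:R = 0 :> {poly R} by rewrite -[p%:R]polyC_natr pR polyC0.
pose yk k := iter k (rad x) y; pose zk k := iter k (rad x) z.
have cX (u v : R) : u%:P * 'X * v%:P = (u * v)%:P * 'X.
  by rewrite -mulrA -commr_polyX polyCM !mulrA.
have radY k : iter k (rad x%:P) Y = (yk k)%:P + (zk k)%:P * 'X.
  elim: k => // k IH; rewrite iterS IH /yk /zk !iterS -/(yk k) -/(zk k).
  move: (yk k) (zk k) => u v; rewrite /rad !polyCB !polyCM mulrDl mulrDr.
  by rewrite cX polyCM opprD addrACA mulrBl !mulrA.
have cXX (u v : R) : u%:P * 'X * (v%:P * 'X) = (u * v)%:P * ('X * 'X).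
  by rewrite mulrA cX mulrA.
have cY k : Y * iter k (rad x%:P) Y = iter k (rad x%:P) Y * Y.
  have := (cy k, cz k, cyz k); rewrite radY /Y -/(yk k) -/(zk k).
  move: (yk k) (zk k) => u v [[cu cv] cuv].
  rewrite !(mulrDl, mulrDr) !cXX !cX -!polyCM cu cv -!addrA; congr (_ + _).
  by rewrite !mulrA -!polyCM !addrA -!mulrDl -!polyCD cuv [v * y + _]addrC.
have := hochschild_nz pP cY => /(congr1 (fun r : {poly R} => r`_1)).
rewrite {1}/Y addrA -polyCD !coefD !coef1_line_exp radY coefD coefMX !coefC /=.
rewrite -polyC_exp coefC !add0r.
by rewrite (iter_rad_prime (x + y)) // (iter_rad_prime y) // => ->.
Qed.

(** Tensor products of algebras come as possibly trivial rings, whereas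
    polynomials have coefficients in a nontrivial one. *)
Lemma pzRing_trivial_or_nz (R : pzRingType) :
  (forall a b : R, a = b) \/ exists R' : nzRingType, R = R' :> pzRingType.
Proof.
have [e|ne] := eqVneq (1 : R) 0.
  by left=> a b; rewrite -[a]mulr1 -[b]mulr1 e !mulr0.
right; exists (HB.pack_for nzRingType (GRing.PzRing.sort R)
  (GRing.PzSemiRing_isNonZero.Build R ne)).
by case: R ne => T [].
Qed.

Lemma hochschild (R : pzRingType) (x y : R) : p%:R = 0 :> R ->
  (forall k, y * iter k (rad x) y = iter k (rad x) y * y) ->
  (x + y) ^+ p = x ^+ p + y ^+ p + iter p.-1 (rad x) y.
Proof.
case: (pzRing_trivial_or_nz R) => [triv *|[R' e]]; first exact: triv.
subst R; exact: hochschild_nz.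
Qed.

Lemma hochschild_polarized (R : pzRingType) (x y z : R) : p%:R = 0 :> R ->
  (forall k, y * iter k (rad x) y = iter k (rad x) y * y) ->
  (forall k, z * iter k (rad x) z = iter k (rad x) z * z) ->
  (forall k, y * iter k (rad x) z + z * iter k (rad x) y
           = iter k (rad x) z * y + iter k (rad x) y * z) ->
  iter p.-1 (rad (x + y)) z = iter p.-1 (rad y) z + iter p.-1 (rad x) z.
Proof.
case: (pzRing_trivial_or_nz R) => [triv *|[R' e]]; first exact: triv.
subst R; exact: hochschild_polarized_nz.
Qed.

End HochschildChar.

(** * Linear functionals *)

Section LinearAlgebra.
Variables (K : fieldType) (V : lmodType K).

Lemma span_subspace (S : set V) : subspace (span S).
Proof. by split; [exact: span0 | exact: spanD | exact: spanZ]. Qed.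

Lemma span_sub (S U : set V) x : subspace U -> (forall y, S y -> U y) ->
  span S x -> U x.
Proof. by move=> [U0 UD UZ] SU; elim=> *; auto. Qed.

Lemma subspaceB (U : set V) x y : subspace U -> U x -> U y -> U (x - y).
Proof. by move=> [U0 UD UZ] Ux Uy; apply: UD => //; rewrite -scaleN1r; apply: UZ. Qed.

Lemma subspace_sum (U : set V) (I : Type) (r : seq I) (P : pred I) (F : I -> V) :
  subspace U -> (forall i, P i -> U (F i)) -> U (\sum_(i <- r | P i) F i).
Proof. by move=> [U0 UD UZ] UF; elim/big_rec: _ => // i x Pi; apply/UD/UF. Qed.

(** Zorn's lemma is applied to the sets [M] such that [U ∪ M] is a subspace
    avoiding [v], so that the union of the empty chain causes no trouble. *)
Lemma maximal_subspace_avoiding (U : set V) v : subspace U -> ~ U v ->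
  exists W : set V, [/\ subspace W, (U `<=` W)%classic, ~ W v
    & forall W' : set V, subspace W' -> (W `<=` W')%classic -> ~ W' v ->
        (W' `<=` W)%classic].
Proof.
move=> sU Uv; pose P (M : set V) := subspace (U `|` M)%classic /\ ~ (U `|` M)%classic v.
have [F FP Ftot|M [[sM Mv] Mmax]] := Zorn_bigcup (P := P).
  pose W : set V := (U `|` \bigcup_(X in F) X)%classic.
  have joint x y : W x -> W y -> exists W', [/\ subspace W', (W' `<=` W)%classic, W' x & W' y].
    have inU X : F X -> ((U `|` X) `<=` W)%classic.
      by move=> FX z [Uz|Xz]; [left | right; exists X].
    move=> [Ux|[X FX Xx]] [Uy|[Y FY Yy]].
    - by exists U; split=> // z; left.
    - by exists (U `|` Y)%classic; split; [by case: (FP Y FY)|exact: inU|by left|by right].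
    - by exists (U `|` X)%classic; split; [by case: (FP X FX)|exact: inU|by right|by left].
    - case: (Ftot X Y FX FY) => XY.
        exists (U `|` Y)%classic; split; [by case: (FP Y FY)|exact: inU| |by right].
        by right; apply: XY.
      exists (U `|` X)%classic; split; [by case: (FP X FX)|exact: inU|by right|].
      by right; apply: XY.
  split; last by case=> [//|[X FX Xv]]; case: (FP X FX) => _; apply; right.
  split; first by left; case: sU.
    by move=> x y /joint/[apply] -[W' [[_ WD _] WW Wx Wy]]; apply/WW/WD.
  by move=> c x Wx; case: (joint x x Wx Wx) => W' [[_ _ WZ] WW Wx' _]; apply/WW/WZ.
exists (U `|` M)%classic; split=> //.
move=> W' sW' WW' W'v; apply: contrapT => nW; apply: (Mmax W').
  split; first by move=> x Mx; apply: WW'; right.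
  by move=> W'M; apply: nW => x W'x; right; apply: W'M.
suff UW : (U `|` W')%classic = W' by rewrite /P UW.
by apply/seteqP; split=> x; [case=> // Ux; apply: WW'; left | right].
Qed.

(** A maximal subspace [W] avoiding [v] is a complement of the line through [v];
    the functional is the coordinate along [v]. *)
Lemma separating_functional (U : set V) v : subspace U -> ~ U v ->
  exists f : V -> K, [/\ scalar f, forall u, U u -> f u = 0 & f v = 1].
Proof.
move=> sU Uv; have [W [sW UW Wv Wmax]] := maximal_subspace_avoiding sU Uv.
have [W0 WD WZ] := sW.
have WB x y : W x -> W y -> W (x - y) by exact: subspaceB.
have coord x : exists c : K, W (x - c *: v).
  pose W' : set V := [set y | exists w a, W w /\ y = w + a *: x]%classic.
  have sW' : subspace W'.
    split; first by exists 0, 0; rewrite scale0r addr0.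
      move=> _ _ [w [a [Ww ->]]] [w' [a' [Ww' ->]]].
      by exists (w + w'), (a + a'); rewrite scalerDl addrACA; split=> //; apply: WD.
    move=> c _ [w [a [Ww ->]]]; exists (c *: w), (c * a).
    by rewrite scalerDr scalerA; split=> //; apply: WZ.
  have [[w [a [Ww E]]]|nW'v] := pselect (W' v); last first.
    exists 0; rewrite scale0r subr0; apply: (Wmax W') => //.
      by move=> w Ww; exists w, 0; rewrite scale0r addr0.
    by exists 0, 1; rewrite scale1r add0r.
  have a0 : a != 0.
    by apply/eqP => a0; apply: Wv; rewrite E a0 scale0r addr0.
  (* From v = w + a x one solves x - a^-1 v = - a^-1 w. *)
  exists a^-1; rewrite E scalerDr scalerA mulVf // scale1r opprD addrCA subrr addr0.
  by rewrite -scaleNr; apply: WZ.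
have uniq_coord x c c' : W (x - c *: v) -> W (x - c' *: v) -> c = c'.
  move=> h h'; have [/eqP|cc] := eqVneq (c - c') 0; first by rewrite subr_eq0 => /eqP.
  case: Wv; rewrite -[v]scale1r -(mulVf cc) -scalerA; apply: WZ.
  by have := WB _ _ h' h; rewrite opprB addrC addrA subrK scalerBl.
have [f fP] := choice coord; exists f; split.
- move=> a x y; apply: (uniq_coord (a *: x + y)) => //.
  have -> : a *: x + y - (a *: (f x : K^o) + f y) *: v =
            a *: (x - f x *: v) + (y - f y *: v).
    by rewrite scalerDl scalerBr scalerA opprD addrACA.
  by apply: WD => //; apply: WZ.
- by move=> u /UW Wu; apply: (uniq_coord u) => //; rewrite scale0r subr0.
- by apply: (uniq_coord v) => //; rewrite scale1r subrr.
Qed.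

End LinearAlgebra.

(** * Pointed graded coalgebras *)

Section PointedCriterion.
Variables (K : fieldType) (C : lmodType K) (Delta : C -> C ⊗ C) (eps : C -> K).
Hypothesis coalgC : is_coalgebra Delta eps.

(** The contraction [f ⊗ id]; a subcoalgebra is stable under [(f ⊗ id) Delta]. *)
Definition lcontract (f : C -> K) : C ⊗ C -> C := tlift (fun a b => f a *: b).

Lemma lcontract_bilin (f : C -> K) : scalar f -> bilin (fun a b : C => f a *: b).
Proof.
move=> fl; split=> [w c v v'|v c w w'].
  by rewrite fl scalerDl scalerA.
by rewrite scalerDr !scalerA mulrC.
Qed.

Lemma lcontract_linear f : scalar f -> linear (lcontract f).
Proof. by move=> fl; apply/tlift_linear/lcontract_bilin. Qed.

Lemma lcontract_pure f a b : scalar f -> lcontract f (a ⊗ b) = f a *: b.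
Proof. by move=> fl; rewrite /lcontract tlift_pure //; apply: lcontract_bilin. Qed.

Lemma span_contract f (S : set (C ⊗ C)) (U : set C) t : scalar f -> subspace U ->
  (forall s, S s -> U (lcontract f s)) -> span S t -> U (lcontract f t).
Proof.
move=> fl [U0 UD UZ] SU; have ll := lcontract_linear fl.
elim=> [s /SU //||s s' _ h _ h'|c s _ h].
- by rewrite (linear_0 ll).
- by rewrite (linear_D _ _ ll); apply: UD.
- by rewrite (linear_Z _ _ ll); apply: UZ.
Qed.

Lemma subcoalgebra_contract D f x : subcoalgebra Delta D -> scalar f -> D x ->
  D (lcontract f (Delta x)).
Proof.
move=> [sD DD] fl /DD; apply: span_contract => // _ [a [b [Da Db ->]]].
by rewrite lcontract_pure //; case: sD => _ _; apply.
Qed.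

Lemma line_subcoalgebra x : grouplike Delta eps x ->
  subcoalgebra Delta [set y | exists c, y = c *: x]%classic.
Proof.
move=> [gx _]; split; first split.
- by exists 0; rewrite scale0r.
- by move=> _ _ [c ->] [c' ->]; exists (c + c'); rewrite scalerDl.
- by move=> c _ [c' ->]; exists (c * c'); rewrite scalerA.
move=> _ [c ->]; rewrite (linear_Z _ _ (comul_linear coalgC)) gx.
by apply/spanZ/span_gen; exists x, x; split=> //; exists 1; rewrite scale1r.
Qed.

Lemma grouplike_neq0 x : grouplike Delta eps x -> x != 0.
Proof.
move=> [_ ex]; apply/eqP => x0; move: ex.
rewrite x0 (linear_0 (V := K^o) (counit_scalar coalgC)) => /esym/eqP.
by rewrite oner_eq0.
Qed.

Lemma line_simple x : grouplike Delta eps x ->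
  simple_subcoalgebra Delta [set y | exists c, y = c *: x]%classic.
Proof.
move=> gx; split; first exact: line_subcoalgebra.
  have x0 := grouplike_neq0 gx; move/seteqP => [/(_ x) h _].
  by case/eqP: x0; apply: h; exists 1; rewrite scale1r.
move=> E [[E0 ED EZ] _] sub.
have [[y [Ey /eqP y0]]|nE] := pselect (exists y, E y /\ y <> 0).
  right; apply/seteqP; split=> // _ [c ->].
  have [a ya] := sub _ Ey.
  have a0 : a != 0 by apply: contraNneq y0 => a0; rewrite ya a0 scale0r.
  have -> : c *: x = (c / a) *: y by rewrite ya scalerA divfK.
  exact: EZ.
left; apply/seteqP; split=> [y Ey|_ ->//].
by apply: contrapT => y0; apply: nE; exists y.
Qed.

Lemma simple_containing_grouplike D x : simple_subcoalgebra Delta D ->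
  grouplike Delta eps x -> D x -> forall y, D y -> exists c, y = c *: x.
Proof.
move=> [[[D0 DD DZ] _] _ Dmin] gx Dx.
have sub : ([set y | exists c, y = c *: x] `<=` D)%classic.
  by move=> _ [c ->]; apply: DZ.
case: (Dmin _ (line_subcoalgebra gx) sub) => [E|<- //].
have /eqP[] := grouplike_neq0 gx.
by have : [set 0]%classic x by rewrite -E; exists 1; rewrite scale1r.
Qed.

Lemma span_mono (S S' : set C) x : (S `<=` S')%classic -> span S x -> span S' x.
Proof. by move=> SS'; apply: span_sub (span_subspace _) _ => y /SS'; apply: span_gen. Qed.

Lemma span_finite (S : set C) x : span S x ->
  exists2 s : seq C, (forall y, y \in s -> S y) & span [set` s] x.
Proof.
elim=> {x} [x Sx||x y _ [s sS sx] _ [t tS ty]|c x _ [s sS sx]].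
- exists [:: x]; first by move=> y; rewrite inE => /eqP ->.
  by apply: span_gen => /=; rewrite inE.
- by exists [::] => //; exact: span0.
- exists (s ++ t); first by move=> z; rewrite mem_cat => /orP[/sS|/tS].
  by apply: spanD; [apply: span_mono sx | apply: span_mono ty] => z /= h;
    rewrite mem_cat h ?orbT.
- by exists s => //; apply: spanZ.
Qed.

Lemma span_cons y (s : seq C) x : span [set` y :: s] x ->
  exists a, span [set` s] (x - a *: y).
Proof.
elim=> {x} [x /=||x z _ [a ha] _ [b hb]|c x _ [a ha]].
- rewrite inE => /predU1P[->|xs]; first by exists 1; rewrite scale1r subrr; exact: span0.
  by exists 0; rewrite scale0r subr0; exact: span_gen.
- by exists 0; rewrite scale0r subr0; exact: span0.
- by exists (a + b); rewrite scalerDl opprD addrACA; apply: spanD.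
- by exists (c * a); rewrite -scalerA -scalerBr; apply: spanZ.
Qed.

(** Let [x] be a combination of grouplike elements [y, z, ...]. A functional
    equal to 1 at [y] and to 0 at the others turns [x] into a multiple of [y],
    unless [y] depends on the others or does not occur in [x]: then the list of
    grouplike elements can be shortened. *)
Lemma subcoalgebra_grouplike D x : subcoalgebra Delta D -> D x -> x != 0 ->
  span (grouplike Delta eps) x -> exists2 y, grouplike Delta eps y & D y.
Proof.
move=> sD Dx x0 /span_finite[s]; have lD := comul_linear coalgC.
elim: s => [_ sx|y s IH gs /[dup] sx /span_cons[a sz]].
  case/eqP: x0; apply: (span_sub (U := [set 0]%classic) _ _ sx) => [|z //].
  by split=> // [_ _ -> -> /=|c _ -> /=]; rewrite ?addr0 ?scaler0.
have gs' z : z \in s -> grouplike Delta eps z.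
  by move=> zs; apply: gs; rewrite inE zs orbT.
have gy : grouplike Delta eps y by apply: gs; rewrite inE eqxx.
have [sy|nsy] := pselect (span [set` s] y).
  apply: IH => //; apply: (span_sub (span_subspace _) _ sx) => z /=.
  by rewrite inE => /predU1P[->//|zs]; apply: span_gen.
have [f [fl fs fy]] := separating_functional (span_subspace _) nsy.
have ll := lcontract_linear fl.
have contr_g z : grouplike Delta eps z -> lcontract f (Delta z) = f z *: z.
  by move=> [-> _]; rewrite lcontract_pure.
have contr_s z : span [set` s] z -> lcontract f (Delta z) = 0.
  elim=> {z} [z zs||u v _ hu _ hv|c u _ hu].
  - by rewrite contr_g ?fs ?scale0r //; [exact: span_gen | exact: gs'].
  - by rewrite (linear_0 lD) (linear_0 ll).
  - by rewrite (linear_D _ _ lD) (linear_D _ _ ll) hu hv addr0.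
  - by rewrite (linear_Z _ _ lD) (linear_Z _ _ ll) hu scaler0.
have [a0|a0] := eqVneq a 0.
  by apply: IH => //; move: sz; rewrite a0 scale0r subr0.
have : D (lcontract f (Delta x)) by exact: subcoalgebra_contract.
have -> : x = a *: y + (x - a *: y) by rewrite addrC subrK.
rewrite (lD a) (ll a) (contr_s _ sz) addr0 contr_g // fy scale1r => Day.
exists y => //; case: sD => [[_ _ DZ] _].
by rewrite -[y]scale1r -(mulVf a0) -scalerA; apply: DZ.
Qed.

(** From here on, [C] is graded as a coalgebra and its degree 0 part is spanned
    by grouplike elements. *)
Variable deg : nat -> set C.
Hypothesis deg_subspace : forall d, subspace (deg d).
Hypothesis deg_sum : forall x, exists (m : nat) (c : nat -> C),
  (forall d, deg d (c d)) /\ x = \sum_(d < m) c d.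
Hypothesis deg_comul : forall d x, deg d x ->
  span [set t | exists i j a b,
    [/\ (i + j)%N = d, deg i a, deg j b & t = a ⊗ b]]%classic (Delta x).
Hypothesis deg0_grouplike : forall x, deg 0%N x -> span (grouplike Delta eps) x.

(** The filtration by degree, shifted by one: the elements of degree less than
    [m]. *)
Let filt m : set C := [set x | exists c : nat -> C,
  (forall d, deg d (c d)) /\ x = \sum_(d < m) c d]%classic.

Let filt_subspace m : subspace (filt m).
Proof.
split.
- exists (fun=> 0); split; first by move=> d; case: (deg_subspace d).
  by rewrite big1.
- move=> _ _ [c [hc ->]] [c' [hc' ->]]; exists (fun d => c d + c' d).
  by rewrite big_split; split=> // d; case: (deg_subspace d) => _ + _; apply.
- move=> a _ [c [hc ->]]; exists (fun d => a *: c d).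
  by rewrite scaler_sumr; split=> // d; case: (deg_subspace d) => _ _; apply.
Qed.

Let deg_filt i m x : (i < m)%N -> deg i x -> filt m x.
Proof.
move=> im dx; exists (fun d => if d == i then x else 0); split.
  by move=> d; case: eqP => [->//|_]; case: (deg_subspace d).
rewrite (bigD1 (Ordinal im)) //= eqxx big1 ?addr0 // => j.
by rewrite -val_eqE /= => /negPf ->.
Qed.

(** Take a nonzero [x] in [D] of least possible degree [m], and assume [m > 0].
    Some functional [f] vanishes in degrees less than [m] and has [f x = 1]. Then
    [(f ⊗ id) (Delta x)] is in [D] and has degree 0, and its counit is [f x = 1]:
    it is a nonzero element of [D] of smaller degree. *)
Lemma simple_meets_deg0 D : simple_subcoalgebra Delta D ->
  exists2 x, D x & deg 0%N x /\ x != 0.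
Proof.
move=> [sD Dn0 _]; have [[D0 DD DZ] _] := sD; have lD := comul_linear coalgC.
have [y [Dy y0]] : exists y, D y /\ y != 0.
  apply: contrapT => nD; apply: Dn0; apply/seteqP; split=> [y Dy|_ -> //].
  by apply: contrapT => /eqP y0; apply: nD; exists y.
have : exists m, `[< exists2 x, D x & filt m x /\ x != 0 >].
  have [m [c [dc yE]]] := deg_sum y; exists m; apply/asboolP.
  by exists y => //; split=> //; exists c.
move=> /ex_minnP[m /asboolP[x Dx [Fx x0]] mmin].
case: m => [|m] in Fx mmin.
  by case: Fx x0 => c [_ ->]; rewrite big_ord0 eqxx.
case: m => [|m] in Fx mmin.
  exists x => //; split=> //; case: Fx => c [dc ->].
  by rewrite big_ord1.
have nFx : ~ filt m.+1 x.
  move=> F'x; suff : (m.+2 <= m.+1)%N by rewrite ltnn.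
  by apply: mmin; apply/asboolP; exists x.
(* Minimality forces x out of filt m.+1, the elements of degree at most m. *)
have [f [fl fF fx]] := separating_functional (filt_subspace _) nFx.
have ll := lcontract_linear fl.
pose u := lcontract f (Delta x).
have Du : D u by exact: subcoalgebra_contract.
have du : deg 0%N u.
  rewrite /u; case: Fx => c [dc ->].
  have : subspace [set z | deg 0%N (lcontract f (Delta z))]%classic.
    have [h0 hD hZ] := deg_subspace 0; split=> /=.
    - by rewrite (linear_0 lD) (linear_0 ll).
    - by move=> z z' hz hz'; rewrite (linear_D _ _ lD) (linear_D _ _ ll); apply: hD.
    - by move=> a z hz; rewrite (linear_Z _ _ lD) (linear_Z _ _ ll); apply: hZ.
  move=> /subspace_sum; apply => i _ /=.
  apply: span_contract (deg_comul (dc i)) => // _ [k [l [a [b [kl da db ->]]]]].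
  rewrite lcontract_pure //; have [h0 _ hZ] := deg_subspace 0.
  have [km|mk] := ltnP k m.+1; first by rewrite fF ?scale0r //; exact: deg_filt da.
  have l0 : l = 0%N by have := ltn_ord i; lia.
  by apply: hZ; rewrite -l0.
have eu : eps u = 1.
  have le := counit_scalar coalgC.
  rewrite -fx -[in RHS](comul_counitr coalgC x) /u.
  have bl : bilin (fun a b : C => eps b *: a).
    split=> [w a v v'|v a w w']; first by rewrite scalerDr !scalerA mulrC.
    by rewrite (le a w w') scalerDl scalerA.
  apply: (@eq_linear_tens K K^o C C (fun t => eps (lcontract f t))
           (fun t => f (tlift (fun a b => eps b *: a) t))).
  - by move=> a s t; rewrite ll; exact: le.
  - by move=> a s t; rewrite (tlift_linear bl); exact: fl.
  - move=> v w; rewrite lcontract_pure // tlift_pure //.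
    rewrite (linear_Z (V := K^o) _ _ le) (linear_Z (V := K^o) _ _ fl).
    exact: mulrC.
have u0 : u != 0.
  apply/eqP => u0; move: eu; rewrite u0 (linear_0 (V := K^o) (counit_scalar coalgC)).
  by move/esym/eqP; rewrite oner_eq0.
suff : (m.+2 <= 1)%N by [].
by apply: mmin; apply/asboolP; exists u => //; split=> //; exact: deg_filt du.
Qed.

(** A simple subcoalgebra meets degree 0, hence contains a grouplike element,
    hence is the line spanned by it. *)
Theorem pointed_of_deg0_grouplike : pointed Delta eps.
Proof.
apply/seteqP; split=> x; last first.
  apply: span_sub (span_subspace _) _ => y gy; apply: span_gen.
  by exists [set z | exists c, z = c *: y]%classic; [exact: line_simple | exists 1; rewrite scale1r].
apply: span_sub (span_subspace _) _ => y [D simD Dy].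
have [z Dz [dz z0]] := simple_meets_deg0 simD.
have [sD _ _] := simD.
have [g gg Dg] := subcoalgebra_grouplike sD Dz z0 (deg0_grouplike dz).
have [c ->] := simple_containing_grouplike simD gg Dg Dy.
exact/spanZ/span_gen.
Qed.
End PointedCriterion.

(** * Lyndon words with one or two letters g *)

Section Words.
Local Open Scope nat_scope.

Lemma word_lt_cons a b v w :
  word_lt (a :: v) (b :: w) = (~~ a && b) || (a == b) && word_lt v w.
Proof. by rewrite /word_lt Order.SeqLexiOrder.ltxi_cons; case: a; case: b. Qed.

Lemma word_ltxx v : word_lt v v = false.
Proof. exact: Order.POrderTheory.ltxx. Qed.

Lemma word_lt_cat2l u v w : word_lt (u ++ v) (u ++ w) = word_lt v w.
Proof. by elim: u => //= a u IH; rewrite word_lt_cons eqxx andNb. Qed.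

Lemma lyndon_startP w : lyndon (lg :: w) <->
  (forall u v, v <> [::] -> w = u ++ v -> word_lt (lg :: w) (v ++ lg :: u)).
Proof.
split=> [/lyndonP[_ [w1|h]] u v v0 wE|h].
- by case: u v v0 wE => [|a u] [|b v] // _ E; move: w1; rewrite E.
- by apply: (h (lg :: u) v) => //; rewrite wE.
- apply/lyndonP; split=> //; right=> -[|a u] v // _ v0 [<- wE].
  exact: h.
Qed.

(** Moving the initial [h] to the end does not increase a word. *)
Lemma lyndon_start_h v : lyndon (lh :: v) -> v = [::].
Proof.
have nlt u : word_lt (lh :: u) (u ++ [:: lh]) = false.
  by elim: u => [|a u IH]; [exact: word_ltxx | rewrite word_lt_cons; case: a].
case/lyndonP=> _ [[/size0nil //]|]; case: v => // a v /(_ [:: lh] (a :: v)).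
by rewrite nlt => /(_ _ _ erefl) hF; have : false by apply: hF.
Qed.

Lemma suffix_nseq_h k u v : nseq k lh = u ++ v -> v = nseq (size v) lh.
Proof.
move=> E; apply/all_pred1P; have : all (pred1 lh) (u ++ v).
  by rewrite -E; apply/all_pred1P; rewrite size_nseq.
by rewrite all_cat => /andP[].
Qed.

Lemma lyndon_omega k : lyndon (omega k).
Proof.
apply/lyndon_startP => u v v0 /suffix_nseq_h; case: v v0 => // a v _ /= [-> _].
by rewrite word_lt_cons.
Qed.

Lemma count_g_nseq_h k : count_mem lg (nseq k lh) = 0.
Proof. by rewrite count_nseq mul0n. Qed.

Lemma cut_at_g i j u v : u ++ lg :: v = nseq i lh ++ lg :: nseq j lh ->
  u = nseq i lh /\ v = nseq j lh.
Proof.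
elim: i u => [|i IH] [|a u] //=; first by case.
  case=> -> E; have := congr1 (count_mem lg) E.
  by rewrite count_cat count_g_nseq_h /= addnCA.
by case=> -> /IH[-> ->].
Qed.

Lemma omega_cat i j : omega i ++ omega j = lg :: nseq i lh ++ lg :: nseq j lh.
Proof. by []. Qed.

Lemma lyndon_omega_cat i j : i < j -> lyndon (omega i ++ omega j).
Proof.
move=> ij; rewrite omega_cat; apply/lyndon_startP => u [|[] v] // _.
move/esym/cut_at_g => [-> ->]; rewrite /= word_lt_cons /=.
have jE : nseq j lh = nseq i lh ++ lh :: nseq (j - i.+1) lh.
  by rewrite -[lh :: _]/(nseq (j - i.+1).+1 lh) -nseqD; congr nseq; lia.
by rewrite {2}jE -catA word_lt_cat2l word_lt_cons.
Qed.

Lemma lyndon_one_g w : lyndon w -> count_mem lg w = 1 -> w = omega (size w).-1.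
Proof.
case: w => // -[] w; first by move/lyndon_start_h => -> /=.
move=> _ [/eqP]; rewrite -leqn0 leqNgt -has_count -all_predC => h.
congr (_ :: _); apply/all_pred1P; apply: sub_all h => b /=; by case: b.
Qed.

End Words.

(** * The brackets of Lyndon words with at least two letters g *)

Section Brackets.
Variables (R : nzRingType) (g h : R).
Local Notation E := (Ebr g h).

Lemma Ebr_omegaS k : E (omega k.+1) = comm (E (omega k)) h.
Proof.
have wE : omega k.+1 = omega k ++ [:: lh] by rewrite /omega -addn1 nseqD.
rewrite wE Ebr_std // -?wE ?lyndon_omega // => -[|a u] v // [_ E] _.
rewrite {1}(@suffix_nseq_h k.+1 u v (esym E)).
by case: (size v) => // n /lyndon_start_h/(congr1 size) /=; rewrite size_nseq => ->.
Qed.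

Lemma Ebr_omega_cat i j : (i < j)%N ->
  E (omega i ++ omega j) = comm (E (omega i)) (E (omega j)).
Proof.
move=> ij; apply: Ebr_std; rewrite ?lyndon_omega ?lyndon_omega_cat //.
move=> [|a u] [|[] v] //; rewrite omega_cat => -[_ E] _.
  by move/lyndon_start_h ->.
by case/cut_at_g: E => _ ->.
Qed.

(** [P] is a two-sided ideal. If both standard factors contain a single [g],
    they are [g h^i] and [g h^j]; otherwise one of them contains at least two,
    and induction applies to it. When there is no cut into two Lyndon words,
    [std_cut] is the length of the word, and the bracket with the empty right
    factor is zero. *)
Lemma Ebr_two_g (P : R -> Prop) : P 0 -> (forall x y, P x -> P y -> P (x - y)) ->
  (forall x y, P x -> P (x * y) /\ P (y * x)) ->
  (forall i j, P (comm (E (omega i)) (E (omega j)))) ->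
  forall w, lyndon w -> (2 <= count_mem lg w)%N -> P (E w).
Proof.
move=> P0 PB PM Pw w lw; rewrite /E; have: (size w <= size w)%N by [].
move: {2 3}(size w) => k; elim: k w lw => [|k IH] w lw sw gw.
  by move: sw gw; rewrite leqn0 => /nilP ->.
have w1 : (1 < size w)%N by apply: leq_trans gw (count_size _ _).
rewrite Ebr_recS //; set i := std_cut w.
have Pc x y : P x \/ P y -> P (comm x y).
  by case=> /PM hx; rewrite /comm; apply: PB; case: (hx x); case: (hx y).
have [iw|iw] := ltnP i (size w); last first.
  by rewrite (drop_oversize iw) Ebr_rec0; apply: Pc; right.
have /andP[lt ld] : lyndon (take i w) && lyndon (drop i w).
  have hs : has (fun i => lyndon (take i w) && lyndon (drop i w)) (iota 1 (size w).-1).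
    rewrite has_find size_iota; move: iw; rewrite /i /std_cut; lia.
  have := nth_find 0%N hs; rewrite nth_iota //.
  by move: hs; rewrite has_find size_iota.
have i0 : (0 < i)%N by [].
have st : (size (take i w) <= k)%N by rewrite size_take iw; lia.
have sd : (size (drop i w) <= k)%N by rewrite size_drop; lia.
have cE : (count_mem lg (take i w) + count_mem lg (drop i w) = count_mem lg w)%N.
  by rewrite -count_cat cat_take_drop.
have [gt|gt] := leqP 2 (count_mem lg (take i w)); first by apply: Pc; left; exact: IH.
have [gd|gd] := leqP 2 (count_mem lg (drop i w)); first by apply: Pc; right; exact: IH.
have ot := lyndon_one_g lt; have od := lyndon_one_g ld.
have -> : Ebr_rec g h k (take i w) = E (take i w) by exact: Ebr_rec_fuel.
have -> : Ebr_rec g h k (drop i w) = E (drop i w) by exact: Ebr_rec_fuel.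
rewrite ot; last by lia.
by rewrite od; last by lia.
Qed.

End Brackets.

(** * Linear and multiplicative maps on tensor products *)

Section TensorLinear.
Variable K : fieldType.
Implicit Types U V W : lmodType K.

Lemma tpureDl V W (v v' : V) (w : W) : (v + v') ⊗ w = v ⊗ w + v' ⊗ w.
Proof. exact: linear_D (tpure_linearl w). Qed.
Lemma tpureDr V W (v : V) (w w' : W) : v ⊗ (w + w') = v ⊗ w + v ⊗ w'.
Proof. exact: linear_D (tpure_linearr v). Qed.
Lemma tpureZl V W c (v : V) (w : W) : (c *: v) ⊗ w = c *: (v ⊗ w).
Proof. exact: linear_Z (tpure_linearl w). Qed.
Lemma tpureZr V W c (v : V) (w : W) : v ⊗ (c *: w) = c *: (v ⊗ w).
Proof. exact: linear_Z (tpure_linearr v). Qed.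
Lemma tpure0l V W (w : W) : (0 : V) ⊗ w = 0.
Proof. exact: linear_0 (tpure_linearl w). Qed.
Lemma tpure0r V W (v : V) : v ⊗ (0 : W) = 0.
Proof. exact: linear_0 (tpure_linearr v). Qed.
Lemma tpureBl V W (v v' : V) (w : W) : (v - v') ⊗ w = v ⊗ w - v' ⊗ w.
Proof. by rewrite tpureDl -scaleN1r tpureZl scaleN1r. Qed.
Lemma tpureBr V W (v : V) (w w' : W) : v ⊗ (w - w') = v ⊗ w - v ⊗ w'.
Proof. by rewrite tpureDr -scaleN1r tpureZr scaleN1r. Qed.

Lemma linear_comp U V W (f : V -> W) (g : U -> V) : linear f -> linear g ->
  linear (fun x => f (g x)).
Proof. by move=> fl gl c x y; rewrite gl fl. Qed.

Lemma linear_add V W (f g : V -> W) : linear f -> linear g ->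
  linear (fun x => f x + g x).
Proof. by move=> fl gl c x y; rewrite gl fl scalerDr addrACA. Qed.

Lemma linear_idfun V : linear (idfun : V -> V).
Proof. by []. Qed.

Lemma tmap_bilin V W V' W' (f : V -> V') (g : W -> W') : linear f -> linear g ->
  bilin (fun v w => f v ⊗ g w).
Proof.
by move=> fl gl; split=> [w|v] c x y; rewrite ?fl ?gl ?tpureDl ?tpureDr ?tpureZl ?tpureZr.
Qed.

Lemma tmap_linear V W V' W' (f : V -> V') (g : W -> W') : linear f -> linear g ->
  linear (tmap f g).
Proof. by move=> fl gl; apply/tlift_linear/tmap_bilin. Qed.

Lemma tmap_pure V W V' W' (f : V -> V') (g : W -> W') v w : linear f -> linear g ->
  tmap f g (v ⊗ w) = f v ⊗ g w.
Proof. by move=> fl gl; rewrite /tmap tlift_pure //; apply: tmap_bilin. Qed.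

Lemma tmap_comp V W V' W' V'' W'' (f : V -> V') (g : W -> W') (f' : V' -> V'')
    (g' : W' -> W'') t : linear f -> linear g -> linear f' -> linear g' ->
  tmap f' g' (tmap f g t) = tmap (fun x => f' (f x)) (fun x => g' (g x)) t.
Proof.
move=> fl gl fl' gl'; move: t; apply: eq_linear_tens.
- by apply: linear_comp; apply: tmap_linear.
- by apply: tmap_linear; apply: linear_comp.
- by move=> v w; rewrite !tmap_pure //; apply: linear_comp.
Qed.

Lemma tassoc_inner_bilin U V W (w : W) :
  bilin (fun (u : U) (v : V) => u ⊗ (v ⊗ w)).
Proof.
by split=> [v|u] c x y; rewrite ?tpureDl ?tpureZl ?tpureDr ?tpureZr.
Qed.

Arguments tassoc_inner_bilin {U V W} w.

Lemma tassoc_bilin U V W :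
  bilin (fun (t : tens U V) (w : W) => tlift (fun u v => u ⊗ (v ⊗ w)) t).
Proof.
split=> [w|t]; first exact (tlift_linear (tassoc_inner_bilin w)).
move=> c x y; move: t; apply: eq_linear_tens.
- exact/tlift_linear/tassoc_inner_bilin.
- move=> a s t; rewrite !(tlift_linear (tassoc_inner_bilin _)).
  by rewrite !scalerDr !scalerA mulrC addrACA.
- move=> u v; rewrite !tlift_pure; try exact: tassoc_inner_bilin.
  by rewrite !tpureDr !tpureZr.
Qed.

Lemma tassoc_linear U V W : linear (@tassoc K U V W).
Proof. exact/tlift_linear/tassoc_bilin. Qed.

Lemma tassoc_pure U V W (u : U) (v : V) (w : W) :
  tassoc ((u ⊗ v) ⊗ w) = u ⊗ (v ⊗ w).
Proof.
rewrite /tassoc tlift_pure ?tlift_pure //; first exact: tassoc_inner_bilin.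
exact: tassoc_bilin.
Qed.

End TensorLinear.

Section TensorRing.
Variables (K : fieldType) (A B : algType K).
Implicit Types s t : (A ⊗ B)%type.

Lemma tpureM (a a' : A) (b b' : B) :
  (a ⊗ b) * (a' ⊗ b') = (a * a') ⊗ (b * b') :> (A ⊗ B)%type.
Proof. exact: tmul_pure. Qed.

Lemma tens_scalerAl (c : K) s t : c *: (s * t) = (c *: s) * t.
Proof. exact/esym/tmulZl. Qed.

Lemma tens_scalerAr (c : K) s t : c *: (s * t) = s * (c *: t).
Proof. exact/esym/tmulZr. Qed.

Lemma mull_linear s : linear (fun t => s * t).
Proof. exact: tmul_linearr. Qed.

Lemma mulr_linear s : linear (fun t => t * s).
Proof. exact: tmul_linearl. Qed.

Lemma tpureX (a : A) (b : B) m : (a ⊗ b) ^+ m = (a ^+ m) ⊗ (b ^+ m) :> (A ⊗ B)%type.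
Proof. by elim: m => [//|m IH]; rewrite !exprS IH tpureM. Qed.

Lemma tens_char p : p \in [pchar K] -> p%:R = 0 :> (A ⊗ B)%type.
Proof. by move=> cK; rewrite -scaler_nat (pcharf0 cK) scale0r. Qed.

End TensorRing.

Lemma alg_mull_linear (K : fieldType) (A : algType K) (a : A) :
  linear (fun x => a * x).
Proof. by move=> c x y; rewrite mulrDr -scalerAr. Qed.

Lemma alg_mulr_linear (K : fieldType) (A : algType K) (a : A) :
  linear (fun x => x * a).
Proof. by move=> c x y; rewrite mulrDl -scalerAl. Qed.

Lemma tmap_mul (K : fieldType) (A B A' B' : algType K) (f : A -> A') (g : B -> B') :
  linear f -> linear g -> {morph f : x y / x * y} -> {morph g : x y / x * y} ->
  {morph tmap f g : s t / s * t}.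
Proof.
move=> fl gl fM gM s t; have ml := tmap_linear fl gl.
move: s; apply: eq_linear_tens.
- by apply: linear_comp ml _; apply: mulr_linear.
- by apply: linear_comp (mulr_linear _) ml.
move=> a b; move: t; apply: eq_linear_tens.
- by apply: linear_comp ml _; apply: mull_linear.
- by apply: linear_comp (mull_linear _) ml.
by move=> a' b'; rewrite tpureM !tmap_pure // tpureM fM gM.
Qed.

(** * The free algebra and its grading *)

Section FreeAlgebra.
Variable K : fieldType.
Local Notation T := (Tfree K).
Local Notation g := (Tg K).
Local Notation h := (Th K).

Lemma T_ind (P : T -> Prop) : P 1 -> (forall x, P x -> P (g * x)) ->
  (forall x, P x -> P (h * x)) -> (forall x y, P x -> P y -> P (x + y)) ->
  (forall c x, P x -> P (c *: x)) -> forall x, P x.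
Proof.
move=> P1 Pg Ph PD PZ; apply: fword_ind => //; last by rewrite -(scale0r 1); apply: PZ.
elim=> [|a w IH]; first by rewrite -fword1.
rewrite -cat1s -fwordM; case: a; [exact: Ph | exact: Pg].
Qed.

(** The bracket [E_(g h^k)] in the free algebra. *)
Definition W k : T := Ebr g h (omega k).

Lemma W_iter k : W k = iter k (rad h) g.
Proof. by elim: k => //= k <-; rewrite /W Ebr_omegaS. Qed.

Lemma TDeltaM (x y : T) : TDelta (x * y : T) = TDelta x * TDelta y.
Proof. exact: (TDelta_monoid_morphism K).2. Qed.

Lemma TepsM (x y : T) : Teps K (x * y) = Teps K x * Teps K y :> K.
Proof. exact: rmorphM. Qed.

Lemma Teps1 : Teps K 1 = 1 :> K.
Proof. exact: rmorph1. Qed.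

Lemma TepsX (x : T) m : Teps K (x ^+ m) = Teps K x ^+ m :> K.
Proof. exact: rmorphXn. Qed.

Lemma Teps_scalar : scalar (Teps K).
Proof. exact: linearP. Qed.

Lemma TepsD (x y : T) : Teps K (x + y) = Teps K x + Teps K y :> K.
Proof. exact: raddfD. Qed.

Lemma TepsB (x y : T) : Teps K (x - y) = Teps K x - Teps K y :> K.
Proof. exact: raddfB. Qed.

Lemma TepsZ c (x : T) : Teps K (c *: x) = c * Teps K x :> K.
Proof. exact: (linear_Z (V := K^o) _ _ Teps_scalar). Qed.

Lemma Tdeg_word u : @Tdeg K (count_mem lh u) (fword u).
Proof. by apply: span_gen; exists u. Qed.

Lemma Tdeg1 : @Tdeg K 0 1.
Proof. by rewrite fword1; exact: (Tdeg_word [::]). Qed.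

Lemma Tdeg_g : @Tdeg K 0 g.
Proof. exact: (Tdeg_word [:: lg]). Qed.

Lemma Tdeg_h : @Tdeg K 1 h.
Proof. exact: (Tdeg_word [:: lh]). Qed.

Lemma TdegM i j (x y : T) : @Tdeg K i x -> @Tdeg K j y -> @Tdeg K (i + j) (x * y).
Proof.
move=> dx dy; elim: dx => {x} [_ [u <- ->]||x x' _ hx _ hx'|c x _ hx].
- elim: dy => {y} [_ [v <- ->]||y y' _ hy _ hy'|c y _ hy].
  + by rewrite fwordM -count_cat; exact: Tdeg_word.
  + by rewrite mulr0; exact: span0.
  + by rewrite mulrDr; apply: spanD.
  + by rewrite -scalerAr; apply: spanZ.
- by rewrite mul0r; exact: span0.
- by rewrite mulrDl; apply: spanD.
- by rewrite -scalerAl; apply: spanZ.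
Qed.

(** The bracket of a word that is not Lyndon may be zero, which is homogeneous
    of every degree. *)
Lemma Tdeg_Ebr u : @Tdeg K (count_mem lh u) (Ebr g h u).
Proof.
rewrite /Ebr; elim: (size u) {-2}u => [|k IH] {}u; first exact: span0.
have [|u1] := leqP (size u) 1.
  case: u => [|[] [|]] // _; [by rewrite Ebr_rec0; exact: span0 | exact: Tdeg_h | exact: Tdeg_g].
rewrite Ebr_recS // /comm; set i := std_cut u.
have cE : (count_mem lh (take i u) + count_mem lh (drop i u) = count_mem lh u)%N.
  by rewrite -count_cat cat_take_drop.
apply: (subspaceB (span_subspace _)); first by rewrite -cE; apply: TdegM.
by rewrite -cE addnC; apply: TdegM.
Qed.

Lemma Tdeg_ind (P : nat -> T -> Prop) : P 0%N 1 ->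
  (forall d x, P d x -> P d (g * x)) -> (forall d x, P d x -> P d.+1 (h * x)) ->
  (forall d, P d 0) -> (forall d x y, P d x -> P d y -> P d (x + y)) ->
  (forall d c x, P d x -> P d (c *: x)) -> forall d x, @Tdeg K d x -> P d x.
Proof.
move=> P1 Pg Ph P0 PD PZ d x; elim=> {x} [_ [u <- ->]|//|x y _ ? _ ?|c x _ ?].
- elim: u => [|a u IH]; first by rewrite -fword1.
  by rewrite -cat1s -fwordM; case: a; [exact: Ph | exact: Pg].
- exact: PD.
- exact: PZ.
Qed.

(** The projection onto the component of degree [d]. *)
Definition Tproj (d : nat) (x : T) : T :=
  fext (fun u : seq bool => if count_mem lh u == d then fword u else 0 : T) x.

Lemma Tproj_linear d : linear (Tproj d).
Proof. exact: fext_linear. Qed.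

Lemma Tproj_word d u : Tproj d (fword u) = if count_mem lh u == d then fword u else 0.
Proof. exact: fextw. Qed.

Lemma Tproj_bigsum d (I : Type) (r : seq I) (P : pred I) (F : I -> T) :
  Tproj d (\sum_(i <- r | P i) F i) = \sum_(i <- r | P i) Tproj d (F i).
Proof.
by elim/big_rec2: _ => [|i x y _ <-]; rewrite ?(linear_0 (Tproj_linear d)) ?(linear_D _ _ (Tproj_linear d)).
Qed.

Lemma Tdeg_Tproj d x : @Tdeg K d (Tproj d x).
Proof.
move: x; apply: fword_ind => [u||x y hx hy|c x hx].
- by rewrite Tproj_word; case: eqP => [<-|_]; [exact: Tdeg_word | exact: span0].
- by rewrite (linear_0 (Tproj_linear d)); exact: span0.
- by rewrite (linear_D _ _ (Tproj_linear d)); apply: spanD.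
- by rewrite (linear_Z _ _ (Tproj_linear d)); apply: spanZ.
Qed.

Lemma Tproj_id d x : @Tdeg K d x -> Tproj d x = x.
Proof.
elim=> {x} [_ [u <- ->]||x y _ hx _ hy|c x _ hx].
- by rewrite Tproj_word eqxx.
- exact: linear_0 (Tproj_linear d).
- by rewrite (linear_D _ _ (Tproj_linear d)) hx hy.
- by rewrite (linear_Z _ _ (Tproj_linear d)) hx.
Qed.

Lemma Tproj_0 d e x : e != d -> @Tdeg K e x -> Tproj d x = 0.
Proof.
move=> ne; elim=> {x} [_ [u uE ->]||x y _ hx _ hy|c x _ hx].
- by rewrite Tproj_word uE (negPf ne).
- exact: linear_0 (Tproj_linear d).
- by rewrite (linear_D _ _ (Tproj_linear d)) hx hy addr0.
- by rewrite (linear_Z _ _ (Tproj_linear d)) hx scaler0.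
Qed.

Lemma Tproj_sum x : exists m, forall m', (m <= m')%N -> x = \sum_(d < m') Tproj d x.
Proof.
move: x; apply: fword_ind => [u||x y [m hx] [m' hy]|c x [m hx]].
- exists (count_mem lh u).+1 => m um; rewrite (bigD1 (Ordinal um)) //= Tproj_word eqxx.
  rewrite big1 ?addr0 // => i; rewrite -val_eqE /= Tproj_word eq_sym.
  by move/negPf ->.
- by exists 0%N => m _; rewrite big1 // => i _; exact: linear_0 (Tproj_linear i).
- exists (maxn m m') => k; rewrite geq_max => /andP[mk mk'].
  rewrite {1}(hx k mk) {1}(hy k mk') -big_split; apply: eq_bigr => i _ /=.
  by rewrite (linear_D _ _ (Tproj_linear i)).
- exists m => k mk; rewrite {1}(hx k mk) scaler_sumr; apply: eq_bigr => i _.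
  by rewrite (linear_Z _ _ (Tproj_linear i)).
Qed.

End FreeAlgebra.
Arguments W {K}.

Lemma rad_morph (R R' : pzRingType) (f : R -> R') x y k :
  {morph f : x y / x - y} -> {morph f : x y / x * y} ->
  f (iter k (rad x) y) = iter k (rad (f x)) (f y).
Proof. by move=> fB fM; elim: k => //= k IH; rewrite /rad fB !fM IH. Qed.

(** * The presented algebra *)

Definition Trel (K : fieldType) (n p : nat) : set (Tfree K) :=
  [set r | [\/ Tbar_rel r, r = Tg K ^+ n - 1, r = W p.-1 | r = Th K ^+ p]]%classic.

(** [H] is the free algebra modulo the relations [Trel]. Linear maps on [H] are
    obtained from linear maps on the free algebra by composition with a section
    [sec] of the projection. *)
Section Presentation.
Variables (K : fieldType) (n p : nat) (charK : p \in [pchar K]).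
Hypotheses (n_gt0 : (0 < n)%N).
Local Notation T := (Tfree K).
Variables (H : algType K) (quo : {lrmorphism T -> H}) (sec : H -> T).
Hypothesis secK : cancel sec quo.
Hypothesis quo_ker : forall x, quo x = 0 <-> ideal (@Trel K n p) x.

Let g := quo (Tg K).
Let h := quo (Th K).
Let gi := g ^+ n.-1.
Let w k := iter k (rad h) g.

Let p_pr : prime p := pcharf_prime charK.

Lemma quo_linear : linear quo.
Proof. exact: linearP. Qed.

Lemma quo_rel r : Trel n p r -> quo r = 0.
Proof. by move=> rr; apply/quo_ker/ideal_gen. Qed.

Lemma quo_W k : quo (W k) = w k.
Proof. by rewrite W_iter (rad_morph (f := quo)) //; [exact: rmorphB | exact: rmorphM]. Qed.

Lemma gXn : g ^+ n = 1.
Proof.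
apply/eqP; rewrite -subr_eq0 -[1](rmorph1 quo) -rmorphXn -rmorphB; apply/eqP.
by apply: quo_rel; constructor 2.
Qed.

Lemma hXp : h ^+ p = 0.
Proof. by rewrite -rmorphXn; apply: quo_rel; constructor 4. Qed.

Lemma w_last : w p.-1 = 0.
Proof. by rewrite -quo_W; apply: quo_rel; constructor 3. Qed.

Lemma gVg : gi * g = 1.
Proof. by rewrite -exprSr prednK // gXn. Qed.

Lemma ggV : g * gi = 1.
Proof. by rewrite -exprS prednK // gXn. Qed.

(** For [i < j] the word [g h^i g h^j] is Lyndon with standard factors [g h^i]
    and [g h^j], so its bracket is one of the relations. *)
Lemma w_comm i j : w i * w j = w j * w i.
Proof.
have lt_comm k l : (k < l)%N -> w k * w l = w l * w k.
  move=> kl; apply/eqP; rewrite -subr_eq0 -!quo_W -!rmorphM -rmorphB; apply/eqP.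
  rewrite -[_ - _]/(comm (W k) (W l)) -(Ebr_omega_cat _ _ kl); apply: quo_rel.
  constructor 1; exists (omega k ++ omega l); split=> //; first exact: lyndon_omega_cat.
  by rewrite count_cat /= !count_g_nseq_h.
by case: (ltngtP i j) => [/lt_comm|/lt_comm|->].
Qed.

(** The subalgebra generated by the [w k]; it is commutative and stable under
    the derivation [rad h]. *)
Inductive wsub : H -> Prop :=
| wsub_w k : wsub (w k)
| wsub1 : wsub 1
| wsubD a b : wsub a -> wsub b -> wsub (a + b)
| wsubZ c a : wsub a -> wsub (c *: a)
| wsubM a b : wsub a -> wsub b -> wsub (a * b).

Lemma wsub_g : wsub g.
Proof. exact: (wsub_w 0). Qed.

Lemma wsub_gi : wsub gi.
Proof.
rewrite /gi; elim: n.-1 => [|m IH]; first exact: wsub1.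
by rewrite exprS; apply: wsubM => //; apply: wsub_g.
Qed.

Lemma wsub_comm a b : wsub a -> wsub b -> a * b = b * a.
Proof.
move=> wa wb; elim: wa b wb => {a} [i||a a' _ ha _ ha'|c a _ ha|a a' _ ha _ ha'] b wb.
- elim: wb => {b} [j||b b' _ hb _ hb'|c b _ hb|b b' _ hb _ hb'].
  + exact: w_comm.
  + by rewrite mulr1 mul1r.
  + by rewrite mulrDr mulrDl hb hb'.
  + by rewrite -scalerAr -scalerAl hb.
  + by rewrite mulrA hb -mulrA hb' mulrA.
- by rewrite mulr1 mul1r.
- by rewrite mulrDr mulrDl ha // ha'.
- by rewrite -scalerAr -scalerAl ha.
- by rewrite -mulrA ha' // mulrA ha // mulrA.
Qed.

Lemma wsub_rad a : wsub a -> wsub (rad h a).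
Proof.
elim=> {a} [k||a b wa da wb db|c a _ da|a b wa da wb db].
- exact: (wsub_w k.+1).
- by rewrite /rad mulr1 mul1r subrr -(scale0r 1); apply/wsubZ/wsub1.
- have -> : rad h (a + b) = rad h a + rad h b by rewrite /rad mulrDl mulrDr opprD addrACA.
  exact: wsubD.
- have -> : rad h (c *: a) = c *: rad h a by rewrite /rad -scalerAl -scalerAr scalerBr.
  exact: wsubZ.
- have -> : rad h (a * b) = a * rad h b + rad h a * b.
    by rewrite /rad mulrBr mulrBl !mulrA subrKA.
  by apply: wsubD; apply: wsubM.
Qed.

Lemma kill_ker (V : lmodType K) (f : T -> V) : linear f ->
  (forall u r v, Trel n p r -> f (u * r * v) = 0) -> forall x, quo x = 0 -> f x = 0.
Proof.
move=> fl fr x /quo_ker; elim=> {x} [_ [u [r [v [rr ->]]]]||x y _ hx _ hy|c x _ hx].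
- exact: fr.
- exact: linear_0.
- by rewrite (linear_D _ _ fl) hx hy addr0.
- by rewrite (linear_Z _ _ fl) hx scaler0.
Qed.

(** [sec] is not linear, but its failure to be so lies in the kernel of [quo]. *)
Lemma factor_sec (V : lmodType K) (f : T -> V) : linear f ->
  (forall x, quo x = 0 -> f x = 0) -> forall x, f (sec (quo x)) = f x.
Proof.
move=> fl fk x; apply/eqP; rewrite -subr_eq0 -scaleN1r -(linear_Z _ _ fl).
by rewrite -(linear_D _ _ fl) scaleN1r fk // raddfB /= secK subrr.
Qed.

Lemma factor_linear (V : lmodType K) (f : T -> V) : linear f ->
  (forall x, quo x = 0 -> f x = 0) -> linear (fun y => f (sec y)).
Proof.
move=> fl fk c y z; rewrite -[y]secK -[z]secK -linearP !(factor_sec fl fk).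
exact: fl.
Qed.

(** [H] is spanned by words in [g] and [h], built by multiplication on the left.
    As [H ⊗ (H ⊗ H)] is not given a product, identities such as
    coassociativity are proved by this induction rather than by comparing
    algebra morphisms on generators. *)
Lemma quo_ind (P : H -> Prop) : P 1 -> (forall x, P x -> P (g * x)) ->
  (forall x, P x -> P (h * x)) -> (forall x y, P x -> P y -> P (x + y)) ->
  (forall c x, P x -> P (c *: x)) -> forall x, P x.
Proof.
move=> P1 Pg Ph PD PZ x; rewrite -[x]secK; move: (sec x); apply: T_ind.
- by rewrite rmorph1.
- by move=> y hy; rewrite rmorphM; apply: Pg.
- by move=> y hy; rewrite rmorphM; apply: Ph.
- by move=> y z hy hz; rewrite raddfD; apply: PD.
- by move=> c y hy; rewrite linearZ; apply: PZ.
Qed.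

(** * The comultiplication *)

(** [(id ⊗ quo) Delta]. Keeping the left factor in the free algebra lets the same
    computation serve for the comultiplication, by [quo ⊗ id], and for the
    antipode, by [a ⊗ b |-> S(a) b]. *)
Definition hDelta (x : T) : (T ⊗ H)%type := tmap idfun quo (TDelta x).

Lemma idquo_linear : linear (tmap (idfun : T -> T) quo).
Proof. exact: tmap_linear (@linear_idfun _ _) quo_linear. Qed.

Lemma hDelta_linear : linear hDelta.
Proof. by move=> c x y; rewrite /hDelta TDelta_linear idquo_linear. Qed.

Lemma hDeltaM x y : hDelta (x * y) = hDelta x * hDelta y.
Proof.
rewrite /hDelta TDeltaM tmap_mul //; [exact: quo_linear | exact: rmorphM].
Qed.

Lemma hDelta1 : hDelta 1 = 1.
Proof.
rewrite /hDelta (TDelta_monoid_morphism K).1 (tmap_pure _ _ (@linear_idfun _ _) quo_linear).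
by rewrite (rmorph1 quo).
Qed.

Lemma hDelta_g : hDelta (Tg K) = Tg K ⊗ g.
Proof. by rewrite /hDelta TDelta_g (tmap_pure _ _ (@linear_idfun _ _) quo_linear). Qed.

Lemma hDelta_h : hDelta (Th K) = 1 ⊗ h + Th K ⊗ g.
Proof.
by rewrite /hDelta TDelta_h (linear_D _ _ idquo_linear) !(tmap_pure _ _ (@linear_idfun _ _) quo_linear).
Qed.

Lemma hDelta_rad k x y : hDelta (iter k (rad x) y) = iter k (rad (hDelta x)) (hDelta y).
Proof.
apply: (rad_morph (f := hDelta)) => [a b|]; last exact: hDeltaM.
by rewrite -scaleN1r (linear_D _ _ hDelta_linear) (linear_Z _ _ hDelta_linear) scaleN1r.
Qed.

Lemma rad_1h k (a : T) (b : H) :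
  iter k (rad ((1 : T) ⊗ h)) (a ⊗ b) = a ⊗ iter k (rad h) b.
Proof.
by elim: k => //= k ->; rewrite /rad !tpureM mulr1 mul1r tpureBr.
Qed.

(** Hochschild's formula for [x = 1 ⊗ h] and [y = h ⊗ g], whose iterated
    brackets are [h ⊗ w_k]. The terms [1 ⊗ h^p] and [h ⊗ w_(p-1)] vanish. *)
Lemma hDelta_hXp : hDelta (Th K ^+ p) = (Th K ^+ p) ⊗ (g ^+ p).
Proof.
have -> : hDelta (Th K ^+ p) = hDelta (Th K) ^+ p.
  by elim: (p) => [|m IH]; rewrite ?hDelta1 // !exprS hDeltaM IH.
rewrite hDelta_h hochschild //; first last.
- by move=> k; rewrite rad_1h !tpureM (w_comm 0 k).
- exact: tens_char charK.
by rewrite rad_1h -/(w _) w_last tpure0r addr0 !tpureX hXp tpure0r add0r.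
Qed.

(** [w_(p-1)] is the [(p-1)]-fold bracket of [g] with [h], so the polarized
    formula for [x = 1 ⊗ h], [y = h ⊗ g] and [z = g ⊗ g] computes its coproduct
    as the sum of [w_(p-1) ⊗ g^p] and [g ⊗ w_(p-1)]. *)
Lemma hDelta_W_last : hDelta (W p.-1) = W p.-1 ⊗ (g ^+ p).
Proof.
rewrite W_iter hDelta_rad hDelta_h hDelta_g hochschild_polarized //; first last.
- move=> k; rewrite !rad_1h !tpureM -!(w_comm 0 k) -!tpureDl.
  by rewrite addrC.
- by move=> k; rewrite rad_1h !tpureM (w_comm 0 k).
- by move=> k; rewrite rad_1h !tpureM (w_comm 0 k).
- exact: tens_char charK.
rewrite rad_1h -/(w _) w_last tpure0r addr0.
have E k : iter k (rad (Th K ⊗ g)) (Tg K ⊗ g) = iter k (rad (Th K)) (Tg K) ⊗ (g ^+ k.+1).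
  elim: k => [|k IH]; first by rewrite expr1.
  by rewrite !iterS IH /rad !tpureM -exprSr -exprS -tpureBl.
by rewrite E prednK ?prime_gt0.
Qed.

Definition qDelta (x : T) : (H ⊗ H)%type := tmap quo quo (TDelta x).

Lemma qquo_linear : linear (tmap quo quo).
Proof. exact: tmap_linear quo_linear quo_linear. Qed.

Lemma qDelta_linear : linear qDelta.
Proof. by move=> c x y; rewrite /qDelta TDelta_linear qquo_linear. Qed.

Lemma qDeltaB : {morph qDelta : x y / x - y}.
Proof.
by move=> x y; rewrite -scaleN1r (linear_D _ _ qDelta_linear) (linear_Z _ _ qDelta_linear) scaleN1r.
Qed.

Lemma qDeltaM : {morph qDelta : x y / x * y}.
Proof.
by move=> x y; rewrite /qDelta TDeltaM tmap_mul //; try exact: quo_linear; exact: rmorphM.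
Qed.

Lemma qDelta1 : qDelta 1 = 1.
Proof.
by rewrite /qDelta (TDelta_monoid_morphism K).1 (tmap_pure _ _ quo_linear quo_linear) (rmorph1 quo).
Qed.

Lemma qDelta_g : qDelta (Tg K) = g ⊗ g.
Proof. by rewrite /qDelta TDelta_g (tmap_pure _ _ quo_linear quo_linear). Qed.

Lemma qDelta_h : qDelta (Th K) = 1 ⊗ h + h ⊗ g.
Proof.
by rewrite /qDelta TDelta_h (linear_D _ _ qquo_linear) !(tmap_pure _ _ quo_linear quo_linear) (rmorph1 quo).
Qed.

Lemma qDelta_hDelta x : qDelta x = tmap quo idfun (hDelta x).
Proof.
by rewrite /hDelta tmap_comp //; exact: quo_linear.
Qed.

(** With [A] the subalgebra [wsub], bracketing with [Delta h] maps [a ⊗ b] in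
    [A ⊗ A] to [a ⊗ [b, h] + [a, h] ⊗ b g], again in [A ⊗ A]. So all [Delta w_k]
    are in the commutative algebra [A ⊗ A]. *)
Lemma qDelta_W_comm i j : qDelta (W i) * qDelta (W j) = qDelta (W j) * qDelta (W i).
Proof.
pose S : set (H ⊗ H) := [set t | exists a b, [/\ wsub a, wsub b & t = a ⊗ b]]%classic.
have WS k : span S (qDelta (W k)).
  rewrite W_iter (rad_morph (f := qDelta)); [|exact: qDeltaB|exact: qDeltaM].
  elim: k => [|k]; rewrite qDelta_g.
    by apply: span_gen; exists g, g; split=> //; apply: wsub_g.
  rewrite iterS qDelta_h; set x := _ + _.
  have radx : linear (rad x).
    by move=> c s t; rewrite /rad (mulr_linear x) (mull_linear x) scalerBr opprD addrACA.
  elim=> {k} [_ [a [b [wa wb ->]]]||s t _ hs _ ht|c t _ ht].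
  - have -> : rad x (a ⊗ b) = a ⊗ rad h b + rad h a ⊗ (b * g).
      rewrite /rad /x mulrDr mulrDl !tpureM mulr1 mul1r (wsub_comm wsub_g wb).
      by rewrite tpureBr tpureBl opprD addrACA.
    apply: spanD; apply: span_gen.
      by exists a, (rad h b); split=> //; apply: wsub_rad.
    exists (rad h a), (b * g); split=> //; first exact: wsub_rad.
    exact: wsubM wsub_g.
  - by rewrite (linear_0 radx); exact: span0.
  - by rewrite (linear_D _ _ radx); apply: spanD.
  - by rewrite (linear_Z _ _ radx); apply: spanZ.
have commutant t : subspace [set s : (H ⊗ H)%type | s * t = t * s]%classic.
  split=> [|s s'|c s] /=; first by rewrite mulr0 mul0r.
    by rewrite mulrDl mulrDr => -> ->.
  by rewrite -tens_scalerAl -tens_scalerAr => ->.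
apply: (span_sub (commutant _) _ (WS i)) => _ [a [b [wa wb ->]]] /=; apply: esym.
apply: (span_sub (commutant _) _ (WS j)) => _ [a' [b' [wa' wb' ->]]] /=.
by rewrite !tpureM (wsub_comm wa wa') (wsub_comm wb wb').
Qed.

Lemma qDelta_ker x : quo x = 0 -> qDelta x = 0.
Proof.
move: x; apply: kill_ker qDelta_linear _ => u r v rr.
suff r0 : qDelta r = 0 by rewrite !qDeltaM r0 mulr0 mul0r.
case: rr => [[z [lz gz ->]]|->|->|->].
- apply: (Ebr_two_g (P := fun x => qDelta x = 0)) => //.
  + exact: linear_0 qDelta_linear.
  + by move=> a b ha hb; rewrite qDeltaB ha hb subrr.
  + by move=> a b ha; rewrite !qDeltaM ha mulr0 mul0r.
  + by move=> i j; rewrite /comm qDeltaB !qDeltaM qDelta_W_comm subrr.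
- rewrite qDeltaB qDelta1.
  have -> : qDelta (Tg K ^+ n) = qDelta (Tg K) ^+ n.
    by elim: (n) => [|m IH]; rewrite ?qDelta1 // !exprS qDeltaM IH.
  by rewrite qDelta_g tpureX gXn subrr.
- by rewrite qDelta_hDelta hDelta_W_last tmap_pure // ?quo_W ?w_last ?tpure0l //; exact: quo_linear.
- rewrite qDelta_hDelta hDelta_hXp tmap_pure //; last exact: quo_linear.
  by rewrite rmorphXn -/h hXp tpure0l.
Qed.

Definition Delta (x : H) : (H ⊗ H)%type := qDelta (sec x).

Lemma Delta_quo x : Delta (quo x) = qDelta x.
Proof. exact: factor_sec qDelta_linear qDelta_ker x. Qed.

Lemma Delta_linear : linear Delta.
Proof. exact: factor_linear qDelta_linear qDelta_ker. Qed.

Lemma DeltaM : {morph Delta : x y / x * y}.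
Proof.
by move=> x y; rewrite -[x]secK -[y]secK -rmorphM !Delta_quo qDeltaM.
Qed.

Lemma Delta1 : Delta 1 = 1.
Proof. by rewrite -(rmorph1 quo) Delta_quo qDelta1. Qed.

Lemma Delta_gM x : Delta (g * x) = (g ⊗ g) * Delta x.
Proof. by rewrite DeltaM Delta_quo qDelta_g. Qed.

Lemma Delta_hM x : Delta (h * x) = (1 ⊗ h + h ⊗ g) * Delta x.
Proof. by rewrite DeltaM Delta_quo qDelta_h. Qed.

(** * The counit *)

Lemma Teps_ker x : quo x = 0 -> Teps K x = 0 :> K.
Proof.
move: x; apply: (kill_ker (f := Teps K : T -> K^o)) => [|u r v rr]; first exact: Teps_scalar.
suff r0 : Teps K r = 0 :> K by rewrite !TepsM r0 mulr0 mul0r.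
case: rr => [/Tbar_relP //|->|->|->].
- by rewrite TepsB TepsX Teps1 Teps_g expr1n subrr.
- rewrite /W Teps_Ebr // /= size_nseq; have := prime_gt1 p_pr; lia.
- by rewrite TepsX Teps_h expr0n gtn_eqF // prime_gt0.
Qed.

Definition eps (x : H) : K := Teps K (sec x).

Lemma eps_quo x : eps (quo x) = Teps K x.
Proof. exact: (factor_sec (f := Teps K : T -> K^o) (@Teps_scalar K) Teps_ker x). Qed.

Lemma eps_scalar : scalar eps.
Proof. exact: (factor_linear (f := Teps K : T -> K^o) (@Teps_scalar K) Teps_ker). Qed.

Lemma epsM : {morph eps : x y / x * y}.
Proof. by move=> x y; rewrite -[x]secK -[y]secK -rmorphM !eps_quo TepsM. Qed.

Lemma eps1 : eps 1 = 1.
Proof. by rewrite -(rmorph1 quo) eps_quo Teps1. Qed.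

Lemma eps_gM x : eps (g * x) = eps x.
Proof. by rewrite epsM eps_quo Teps_g mul1r. Qed.

Lemma eps_hM x : eps (h * x) = 0.
Proof. by rewrite epsM eps_quo Teps_h mul0r. Qed.

Lemma epsZ c x : eps (c *: x) = c * eps x.
Proof. exact: (linear_Z (V := K^o) _ _ eps_scalar). Qed.

Lemma epsD x y : eps (x + y) = eps x + eps y.
Proof. exact: (linear_D (V := K^o) _ _ eps_scalar). Qed.

(** * The antipode *)

(** The antimorphism with [g |-> g^-1] and [h |-> - h g^-1]; [gi] is the inverse
    [g^(n-1)] of [g]. *)
Definition Tanti (x : T) : H :=
  fext (fun u : seq bool => \prod_(a <- rev u) (if a == lh then - (h * gi) else gi)) x.

Lemma Tanti_linear : linear Tanti.
Proof. exact: fext_linear. Qed.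

Lemma Tanti1 : Tanti 1 = 1.
Proof. by rewrite /Tanti fword1 fextw big_nil. Qed.

Lemma TantiM x y : Tanti (x * y) = Tanti y * Tanti x.
Proof.
move: x y; apply: (fextM (m := fun a b => b * a)) => [|u v].
  by split=> a; [exact: alg_mull_linear | exact: alg_mulr_linear].
by rewrite rev_cat big_cat.
Qed.

Lemma Tanti_g : Tanti (Tg K) = gi.
Proof. by rewrite /Tanti fextw big_seq1. Qed.

Lemma Tanti_h : Tanti (Th K) = - (h * gi).
Proof. by rewrite /Tanti fextw big_seq1. Qed.

Lemma TantiB : {morph Tanti : x y / x - y}.
Proof.
by move=> x y; rewrite -scaleN1r (linear_D _ _ Tanti_linear) (linear_Z _ _ Tanti_linear) scaleN1r.
Qed.

Definition hconv : (T ⊗ H)%type -> H := tlift (fun a b => Tanti a * b).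

Lemma hconv_bilin : bilin (fun (a : T) (b : H) => Tanti a * b).
Proof.
by split=> [b|a] c x y; rewrite ?Tanti_linear ?mulrDl ?mulrDr -?scalerAl -?scalerAr.
Qed.

Lemma hconv_linear : linear hconv.
Proof. exact: tlift_linear hconv_bilin. Qed.

Lemma hconv_pure a b : hconv (a ⊗ b) = Tanti a * b.
Proof. exact: tlift_pure hconv_bilin. Qed.

(** The antipode identity for [Tanti], before it is known to factor through [H]. *)
Lemma hconv_hDelta x : hconv (hDelta x) = Teps K x *: 1.
Proof.
move: x; apply: T_ind => [|x|x|x y hx hy|c x hx].
- by rewrite hDelta1 hconv_pure Tanti1 mul1r Teps1 scale1r.
- rewrite hDeltaM hDelta_g TepsM Teps_g mul1r => <-.
  move: (hDelta x); apply: eq_linear_tens; last 1 first.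
  + by move=> a b; rewrite tpureM !hconv_pure TantiM Tanti_g -mulrA [gi * _]mulrA gVg mul1r.
  + exact: linear_comp hconv_linear (mull_linear _).
  + exact: hconv_linear.
- rewrite hDeltaM hDelta_h TepsM Teps_h mul0r scale0r => _.
  move: (hDelta x); apply: (eq_linear_tens (g := fun=> 0)); last 1 first.
  + move=> a b; rewrite mulrDl !tpureM mul1r (linear_D _ _ hconv_linear) !hconv_pure.
    rewrite TantiM Tanti_h mulrN mulNr -!mulrA [gi * _]mulrA gVg mul1r.
    by rewrite subrr.
  + exact: linear_comp hconv_linear (mull_linear _).
  + by move=> c s t; rewrite scaler0 addr0.
- by rewrite (linear_D _ _ hDelta_linear) (linear_D _ _ hconv_linear) hx hy TepsD scalerDl.
- by rewrite (linear_Z _ _ hDelta_linear) (linear_Z _ _ hconv_linear) hx TepsZ scalerA.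
Qed.

(** If [a = S(w_k)], then [S(w_(k+1)) = [a, h] g^-1], which is in the subalgebra
    as soon as [a] is. *)
Lemma wsub_Tanti_W k : wsub (Tanti (W k)).
Proof.
elim: k => [|k wk]; first by rewrite /W Tanti_g; apply: wsub_gi.
rewrite W_iter iterS -W_iter /rad TantiB !TantiM Tanti_h mulNr mulrN opprK addrC.
move: (Tanti _) wk => a wa.
have -> : a * (h * gi) - h * gi * a = rad h a * gi.
  by rewrite /rad mulrBl -!mulrA (wsub_comm wsub_gi wa).
by apply: wsubM wsub_gi; apply: wsub_rad.
Qed.

Lemma gXp_cancel a : a * g ^+ p = 0 -> a = 0.
Proof.
elim: (p) => [|m IH]; first by rewrite mulr1.
rewrite exprSr mulrA => /(congr1 (fun b => b * gi)).
by rewrite -[_ * g * gi]mulrA ggV mulr1 mul0r.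
Qed.

(** For [r = w_(p-1)] or [r = h^p], the coproduct of [r] in [T ⊗ H] is
    [r ⊗ g^p], so the antipode identity reads [S(r) g^p = eps r = 0]. *)
Lemma Tanti_ker x : quo x = 0 -> Tanti x = 0.
Proof.
move: x; apply: kill_ker Tanti_linear _ => u r v rr.
suff r0 : Tanti r = 0 by rewrite !TantiM r0 mul0r mulr0.
case: rr => [[z [lz gz ->]]|->|->|->].
- apply: (Ebr_two_g (P := fun x => Tanti x = 0)) => //.
  + exact: linear_0 Tanti_linear.
  + by move=> a b ha hb; rewrite TantiB ha hb subrr.
  + by move=> a b ha; rewrite !TantiM ha mulr0 mul0r.
  + move=> i j; rewrite /comm TantiB !TantiM.
    by rewrite (wsub_comm (wsub_Tanti_W j) (wsub_Tanti_W i)) subrr.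
- rewrite TantiB Tanti1.
  have -> : Tanti (Tg K ^+ n) = gi ^+ n.
    by elim: (n) => [|m IH]; rewrite ?Tanti1 // exprS exprSr TantiM IH Tanti_g.
  by rewrite /gi -exprM mulnC exprM gXn expr1n subrr.
- apply: gXp_cancel; rewrite -hconv_pure -hDelta_W_last hconv_hDelta /W Teps_Ebr ?scale0r //.
  by rewrite /= size_nseq; have := prime_gt1 p_pr; lia.
- apply: gXp_cancel; rewrite -hconv_pure -hDelta_hXp hconv_hDelta.
  by rewrite TepsX Teps_h expr0n gtn_eqF ?scale0r // prime_gt0.
Qed.

Definition anti (x : H) : H := Tanti (sec x).

Lemma anti_quo x : anti (quo x) = Tanti x.
Proof. exact: factor_sec Tanti_linear Tanti_ker x. Qed.

Lemma anti_linear : linear anti.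
Proof. exact: factor_linear Tanti_linear Tanti_ker. Qed.

Lemma antiM x y : anti (x * y) = anti y * anti x.
Proof. by rewrite -[x]secK -[y]secK -rmorphM !anti_quo TantiM. Qed.

Lemma anti_bilinl : bilin (fun a b => anti a * b).
Proof.
by split=> [b|a] c x y; rewrite ?anti_linear ?mulrDl ?mulrDr -?scalerAl -?scalerAr.
Qed.

Lemma anti_bilinr : bilin (fun a b => a * anti b).
Proof.
by split=> [b|a] c x y; rewrite ?anti_linear ?mulrDl ?mulrDr -?scalerAl -?scalerAr.
Qed.

Lemma antipode_left x : tlift (fun a b => anti a * b) (Delta x) = eps x *: 1.
Proof.
rewrite -[x]secK Delta_quo eps_quo -hconv_hDelta qDelta_hDelta.
have qil : linear (tmap quo (idfun : H -> H)) by exact: tmap_linear quo_linear (@linear_idfun _ _).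
move: (hDelta _); apply: eq_linear_tens; last 1 first.
- move=> a b; rewrite tmap_pure //; last exact: quo_linear.
  by rewrite (tlift_pure _ _ anti_bilinl) anti_quo hconv_pure.
- exact: linear_comp (tlift_linear anti_bilinl) qil.
- exact: hconv_linear.
Qed.

Lemma antipode_right x : tlift (fun a b => a * anti b) (Delta x) = eps x *: 1.
Proof.
set f := tlift _; have fl : linear f by exact: tlift_linear anti_bilinr.
have fp a b : f (a ⊗ b) = a * anti b by exact: tlift_pure anti_bilinr.
have fgM t : f ((g ⊗ g) * t) = g * f t * gi.
  move: t; apply: eq_linear_tens; last 1 first.
  - by move=> a b; rewrite tpureM !fp antiM anti_quo Tanti_g !mulrA.
  - exact: linear_comp fl (mull_linear _).
  - exact: linear_comp (alg_mulr_linear gi) (linear_comp (alg_mull_linear g) fl).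
have fhM t : f ((1 ⊗ h + h ⊗ g) * t) = h * f t * gi - f t * (h * gi).
  move: t; apply: eq_linear_tens; last 1 first.
  - move=> a b; rewrite mulrDl !tpureM mul1r (linear_D _ _ fl) !fp !antiM !anti_quo.
    by rewrite Tanti_g Tanti_h mulrN !mulrN addrC !mulrA.
  - exact: linear_comp fl (mull_linear _).
  - move=> c s t; rewrite fl mulrDl mulrDr mulrDl -!scalerAl -!scalerAr -scalerAl.
    by rewrite opprD addrACA -scalerBr.
move: x; apply: quo_ind => [|x|x|x y hx hy|c x hx].
- by rewrite Delta1 fp mul1r -(rmorph1 quo) anti_quo Tanti1 eps_quo Teps1 (rmorph1 quo) scale1r.
- by rewrite Delta_gM fgM eps_gM => ->; rewrite -scalerAr -scalerAl mulr1 ggV.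
- rewrite Delta_hM fhM eps_hM => ->.
  by rewrite -scalerAr -!scalerAl mulr1 mul1r subrr scale0r.
- by rewrite (linear_D _ _ Delta_linear) (linear_D _ _ fl) hx hy epsD scalerDl.
- by rewrite (linear_Z _ _ Delta_linear) (linear_Z _ _ fl) hx epsZ scalerA.
Qed.

(** * The coalgebra axioms *)

Lemma lcounit_bilin : bilin (fun a b : H => eps a *: b).
Proof. exact: lcontract_bilin eps_scalar. Qed.

Lemma rcounit_bilin : bilin (fun a b : H => eps b *: a).
Proof. by split=> [b|a] c x y; rewrite ?scalerDr ?eps_scalar ?scalerDl !scalerA // mulrC. Qed.

Lemma counit_left x : tlift (fun a b => eps a *: b) (Delta x) = x.
Proof.
set f := tlift _; have fl : linear f by exact: tlift_linear lcounit_bilin.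
have fp a b : f (a ⊗ b) = eps a *: b by exact: tlift_pure lcounit_bilin.
have fgM t : f ((g ⊗ g) * t) = g * f t.
  move: t; apply: eq_linear_tens; last 1 first.
  - by move=> a b; rewrite tpureM !fp eps_gM -scalerAr.
  - exact: linear_comp fl (mull_linear _).
  - exact: linear_comp (alg_mull_linear g) fl.
have fhM t : f ((1 ⊗ h + h ⊗ g) * t) = h * f t.
  move: t; apply: eq_linear_tens; last 1 first.
  - move=> a b; rewrite mulrDl !tpureM mul1r (linear_D _ _ fl) !fp eps_hM.
    by rewrite scale0r addr0 -scalerAr.
  - exact: linear_comp fl (mull_linear _).
  - exact: linear_comp (alg_mull_linear h) fl.
move: x; apply: quo_ind => [|x hx|x hx|x y hx hy|c x hx].
- by rewrite Delta1 fp eps1 scale1r.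
- by rewrite Delta_gM fgM hx.
- by rewrite Delta_hM fhM hx.
- by rewrite (linear_D _ _ Delta_linear) (linear_D _ _ fl) hx hy.
- by rewrite (linear_Z _ _ Delta_linear) (linear_Z _ _ fl) hx.
Qed.

Lemma counit_right x : tlift (fun a b => eps b *: a) (Delta x) = x.
Proof.
set f := tlift _; have fl : linear f by exact: tlift_linear rcounit_bilin.
have fp a b : f (a ⊗ b) = eps b *: a by exact: tlift_pure rcounit_bilin.
have fgM t : f ((g ⊗ g) * t) = g * f t.
  move: t; apply: eq_linear_tens; last 1 first.
  - by move=> a b; rewrite tpureM !fp eps_gM -scalerAr.
  - exact: linear_comp fl (mull_linear _).
  - exact: linear_comp (alg_mull_linear g) fl.
have fhM t : f ((1 ⊗ h + h ⊗ g) * t) = h * f t.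
  move: t; apply: eq_linear_tens; last 1 first.
  - move=> a b; rewrite mulrDl !tpureM mul1r (linear_D _ _ fl) !fp eps_hM eps_gM.
    by rewrite scale0r add0r -scalerAr.
  - exact: linear_comp fl (mull_linear _).
  - exact: linear_comp (alg_mull_linear h) fl.
move: x; apply: quo_ind => [|x hx|x hx|x y hx hy|c x hx].
- by rewrite Delta1 fp eps1 scale1r.
- by rewrite Delta_gM fgM hx.
- by rewrite Delta_hM fhM hx.
- by rewrite (linear_D _ _ Delta_linear) (linear_D _ _ fl) hx hy.
- by rewrite (linear_Z _ _ Delta_linear) (linear_Z _ _ fl) hx.
Qed.

(** Both sides, [L (Delta x)] and [R (Delta x)], are transformed in the same way
    when [x] is multiplied on the left by [g] or [h]: by the operators [G] and [F]
    that multiply by [g ⊗ (g ⊗ g)] and by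
    [1 ⊗ (1 ⊗ h) + 1 ⊗ (h ⊗ g) + h ⊗ (g ⊗ g)]. *)
Lemma coassoc x :
  tassoc (tmap Delta idfun (Delta x)) = tmap idfun Delta (Delta x).
Proof.
have idl := @linear_idfun K H; have Dl := Delta_linear.
pose L : (H ⊗ H)%type -> tens H (tens H H) := fun t => tassoc (tmap Delta idfun t).
pose R : (H ⊗ H)%type -> tens H (tens H H) := tmap idfun Delta.
have Ll : linear L := linear_comp (@tassoc_linear K H H H) (tmap_linear Dl idl).
have Rl : linear R := tmap_linear idl Dl.
have tal := @tassoc_linear K H H H.
have Lp a b : L (a ⊗ b) = tassoc (Delta a ⊗ b) by rewrite /L tmap_pure.
have Rp a b : R (a ⊗ b) = a ⊗ Delta b by rewrite /R tmap_pure.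
have gl := alg_mull_linear g; have hl := alg_mull_linear h.
have ggl := mull_linear (g ⊗ g : (H ⊗ H)%type).
have hhl := mull_linear (1 ⊗ h + h ⊗ g : (H ⊗ H)%type).
pose G : tens H (tens H H) -> tens H (tens H H) := tmap ( *%R g) ( *%R (g ⊗ g)).
pose F : tens H (tens H H) -> tens H (tens H H) :=
  fun t => tmap idfun ( *%R (1 ⊗ h + h ⊗ g)) t + tmap ( *%R h) ( *%R (g ⊗ g)) t.
have Gl : linear G by exact: tmap_linear.
have Fl : linear F by apply: linear_add; exact: tmap_linear.
have Gp a t : G (a ⊗ t) = (g * a) ⊗ ((g ⊗ g) * t) by rewrite /G tmap_pure.
have Fp a t : F (a ⊗ t) = a ⊗ ((1 ⊗ h + h ⊗ g) * t) + (h * a) ⊗ ((g ⊗ g) * t).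
  by rewrite /F !tmap_pure.
have taDl (s s' : (H ⊗ H)%type) (b : H) : tassoc ((s + s') ⊗ b) = tassoc (s ⊗ b) + tassoc (s' ⊗ b).
  by rewrite tpureDl (linear_D _ _ tal).
have tabl b : linear (fun s : (H ⊗ H)%type => tassoc (s ⊗ b) : tens H (tens H H)).
  exact: linear_comp tal (tpure_linearl b).
have RG t : R ((g ⊗ g) * t) = G (R t).
  move: t; apply: eq_linear_tens; last 1 first.
  - by move=> a b; rewrite tpureM !Rp Gp Delta_gM.
  - exact: linear_comp Rl ggl.
  - exact: linear_comp Gl Rl.
have RF t : R ((1 ⊗ h + h ⊗ g) * t) = F (R t).
  move: t; apply: eq_linear_tens; last 1 first.
  - by move=> a b; rewrite mulrDl !tpureM mul1r (linear_D _ _ Rl) !Rp Fp Delta_hM Delta_gM.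
  - exact: linear_comp Rl hhl.
  - exact: linear_comp Fl Rl.
have LG t : L ((g ⊗ g) * t) = G (L t).
  move: t; apply: eq_linear_tens; last 1 first.
  - move=> a b; rewrite tpureM !Lp Delta_gM; move: (Delta a); apply: eq_linear_tens; last 1 first.
    + by move=> c d; rewrite tpureM !tassoc_pure Gp tpureM.
    + exact: linear_comp (tabl _) ggl.
    + exact: linear_comp Gl (tabl _).
  - exact: linear_comp Ll ggl.
  - exact: linear_comp Gl Ll.
have LF t : L ((1 ⊗ h + h ⊗ g) * t) = F (L t).
  move: t; apply: eq_linear_tens; last 1 first.
  - move=> a b; rewrite mulrDl !tpureM mul1r (linear_D _ _ Ll) !Lp Delta_hM.
    move: (Delta a); apply: eq_linear_tens; last 1 first.
    + move=> c d; rewrite mulrDl !tpureM mul1r taDl !tassoc_pure Fp mulrDl !tpureM mul1r.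
      by rewrite tpureDr addrA.
    + by apply: linear_add (tabl _) _; apply: linear_comp (tabl _) hhl.
    + exact: linear_comp Fl (tabl _).
  - exact: linear_comp Ll hhl.
  - exact: linear_comp Fl Ll.
rewrite -[LHS]/(L _) -[RHS]/(R _); move: x; apply: quo_ind => [|x hx|x hx|x y hx hy|c x hx].
- by rewrite Delta1 Lp Rp Delta1 tassoc_pure.
- by rewrite Delta_gM LG RG hx.
- by rewrite Delta_hM LF RF hx.
- by rewrite (linear_D _ _ Dl) (linear_D _ _ Ll) (linear_D _ _ Rl) hx hy.
- by rewrite (linear_Z _ _ Dl) (linear_Z _ _ Ll) (linear_Z _ _ Rl) hx.
Qed.

Lemma quo_coalgebra : is_coalgebra Delta eps.
Proof.
split; [exact: Delta_linear|exact: eps_scalar|exact: coassoc|exact: counit_left|exact: counit_right].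
Qed.

Lemma quo_hopf : is_hopf_algebra Delta eps anti.
Proof.
split; [|exact: anti_linear|exact: antipode_left|exact: antipode_right].
split; [exact: quo_coalgebra| |].
- by split; [exact: Delta1 | exact: DeltaM].
- by split; [exact: eps1 | exact: epsM].
Qed.

(** * The grading and pointedness *)

Definition qdeg (d : nat) : set H := [set quo x | x in @Tdeg K d]%classic.

Lemma qdeg_subspace d : subspace (qdeg d).
Proof.
split.
- by exists 0; [exact: span0 | rewrite raddf0].
- by move=> _ _ [x hx <-] [y hy <-]; exists (x + y); [exact: spanD | rewrite raddfD].
- by move=> c _ [x hx <-]; exists (c *: x); [exact: spanZ | rewrite linearZ].
Qed.

(** The relations being homogeneous, [u r v] is homogeneous for words [u] and
    [v], and the projection of the free algebra onto a degree preserves the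
    ideal of relations. *)
Lemma quo_proj d x : quo x = 0 -> quo (Tproj d x) = 0.
Proof.
move: x; apply: kill_ker; first exact: linear_comp quo_linear (Tproj_linear d).
move=> u r v rr.
have [e re] : exists e, @Tdeg K e r.
  case: rr => [[z [_ _ ->]]|->|->|->].
  - by exists (count_mem lh z); apply: Tdeg_Ebr.
  - exists 0%N; apply: (subspaceB (span_subspace _)); last exact: Tdeg1.
    elim: (n) => [|m IH]; first exact: Tdeg1.
    by rewrite exprS; apply: (TdegM (i := 0) (j := 0)) => //; apply: Tdeg_g.
  - by exists (count_mem lh (omega p.-1)); apply: Tdeg_Ebr.
  - exists p; elim: (p) => [|m IH]; first exact: Tdeg1.
    by rewrite exprS; apply: (TdegM (i := 1)) => //; apply: Tdeg_h.
have kl a b : linear (fun u' => quo (Tproj d (a * u' * b))).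
  by move=> c y z; rewrite mulrDr mulrDl -scalerAr -scalerAl Tproj_linear quo_linear.
move: u; apply: fword_ind => [u||a b ha hb|c a ha].
- move: v; apply: fword_ind => [v||a b ha hb|c a ha].
  + have uv : @Tdeg K (count_mem lh u + e + count_mem lh v) (fword u * r * fword v).
      by apply: TdegM; [apply: TdegM => //|]; apply: Tdeg_word.
    have [<-|ne] := eqVneq (count_mem lh u + e + count_mem lh v)%N d.
      by rewrite (Tproj_id uv) !rmorphM /= (quo_rel rr) mulr0 mul0r.
    by rewrite (Tproj_0 ne uv) raddf0.
  + by rewrite mulr0 (linear_0 (Tproj_linear d)) raddf0.
  + by rewrite mulrDr (linear_D _ _ (Tproj_linear d)) raddfD /= ha hb addr0.
  + by rewrite -scalerAr (linear_Z _ _ (Tproj_linear d)) (linear_Z _ _ quo_linear) ha scaler0.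
- by rewrite !mul0r (linear_0 (Tproj_linear d)) raddf0.
- by rewrite !mulrDl (linear_D _ _ (Tproj_linear d)) raddfD /= ha hb addr0.
- by rewrite -!scalerAl (linear_Z _ _ (Tproj_linear d)) (linear_Z _ _ quo_linear) ha scaler0.
Qed.

Lemma quo_grading : is_grading qdeg.
Proof.
split; first exact: qdeg_subspace.
- move=> x; have [m xE] := Tproj_sum (sec x).
  exists m, (fun d => quo (Tproj d (sec x))); split.
    by move=> d; exists (Tproj d (sec x)) => //; apply: Tdeg_Tproj.
  by rewrite -(raddf_sum quo) -xE //= secK.
move=> m c dc c0 d dm.
have ex k : exists y, @Tdeg K k y /\ quo y = c k.
  by case: (dc k) => y dy yE; exists y.
have [x xP] := choice ex.
have s0 : quo (\sum_(i < m) x i) = 0.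
  by rewrite raddf_sum -[RHS]c0; apply: eq_bigr => i _; case: (xP i).
have := quo_proj d s0.
have -> : Tproj d (\sum_(i < m) x i) = x d.
  rewrite Tproj_bigsum (bigD1 (Ordinal dm)) //= big1 ?addr0.
    by apply: Tproj_id; case: (xP d).
  by move=> i; rewrite -val_eqE /= => ne; apply: Tproj_0 ne _; case: (xP i).
by case: (xP d) => _ ->.
Qed.

Lemma qdegM i j x y : qdeg i x -> qdeg j y -> qdeg (i + j) (x * y).
Proof.
by move=> [a da <-] [b db <-]; exists (a * b); [exact: TdegM | rewrite rmorphM].
Qed.

Lemma qdeg1 : qdeg 0 1.
Proof. by exists 1; [exact: Tdeg1 | rewrite rmorph1]. Qed.

Lemma qdeg_g : qdeg 0 g.
Proof. by exists (Tg K); first exact: Tdeg_g. Qed.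

Lemma qdeg_h : qdeg 1 h.
Proof. by exists (Th K); first exact: Tdeg_h. Qed.

Lemma qdeg_gi : qdeg 0 gi.
Proof.
rewrite /gi; elim: n.-1 => [|m IH]; first exact: qdeg1.
by rewrite exprS; apply: (qdegM (i := 0) (j := 0)) => //; apply: qdeg_g.
Qed.

Definition qdeg2 d : set (H ⊗ H)%type := span [set t | exists i j a b,
  [/\ (i + j)%N = d, qdeg i a, qdeg j b & t = a ⊗ b]]%classic.

Lemma qdeg_comul d x : qdeg d x -> qdeg2 d (Delta x).
Proof.
have mulP d' k l a b t : qdeg k a -> qdeg l b -> qdeg2 d' t -> qdeg2 (k + l + d') ((a ⊗ b) * t).
  move=> da db; elim=> {t} [_ [i [j [a' [b' [<- da' db' ->]]]]]||s t _ hs _ ht|c t _ ht].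
  - rewrite tpureM; apply: span_gen; exists (k + i)%N, (l + j)%N, (a * a'), (b * b').
    by split=> //; [lia | exact: qdegM | exact: qdegM].
  - by rewrite mulr0; exact: span0.
  - by rewrite mulrDr; apply: spanD.
  - by rewrite -tens_scalerAr; apply: spanZ.
move=> [y dy <-]; move: y dy; apply: (Tdeg_ind (P := fun e y => qdeg2 e (Delta (quo y)))).
- by rewrite rmorph1 Delta1; apply: span_gen; exists 0%N, 0%N, 1, 1; split=> //; exact: qdeg1.
- move=> e y hy; rewrite rmorphM Delta_gM.
  by apply: (mulP _ 0%N 0%N) => //; exact: qdeg_g.
- move=> e y hy; rewrite rmorphM Delta_hM mulrDl.
  by apply: spanD; [apply: (mulP _ 0%N 1%N) => // | apply: (mulP _ 1%N 0%N) => //];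
    [exact: qdeg1|exact: qdeg_h|exact: qdeg_h|exact: qdeg_g].
- by move=> e; rewrite raddf0 (linear_0 Delta_linear); exact: span0.
- by move=> e y z hy hz; rewrite raddfD (linear_D _ _ Delta_linear); apply: spanD.
- by move=> e c y hy; rewrite (linear_Z _ _ quo_linear) (linear_Z _ _ Delta_linear); apply: spanZ.
Qed.

Lemma qdeg_counit d x : qdeg d x -> d != 0%N -> eps x = 0.
Proof.
move=> [y dy <-]; rewrite eps_quo; move: y dy.
apply: (Tdeg_ind (P := fun e y => e != 0%N -> Teps K y = 0 :> K)) => //.
- by move=> e y hy; rewrite TepsM Teps_g mul1r.
- by move=> e y _ _; rewrite TepsM Teps_h mul0r.
- by move=> e _; exact: (linear_0 (V := K^o) (@Teps_scalar K)).
- by move=> e y z hy hz e0; rewrite TepsD hy // hz // addr0.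
- by move=> e c y hy e0; rewrite TepsZ hy // mulr0.
Qed.

Lemma qdeg_antipode d x : qdeg d x -> qdeg d (anti x).
Proof.
move=> [y dy <-]; rewrite anti_quo; move: y dy.
apply: (Tdeg_ind (P := fun e y => qdeg e (Tanti y))).
- by rewrite Tanti1; exact: qdeg1.
- move=> e y hy; rewrite TantiM Tanti_g -[e]addn0; apply: qdegM hy qdeg_gi.
- move=> e y hy; rewrite TantiM Tanti_h -[e.+1]addn1; apply: qdegM hy _.
  rewrite -scaleN1r; have [_ _ hZ] := qdeg_subspace 1; apply: hZ.
  exact: (qdegM (i := 1) (j := 0)) qdeg_h qdeg_gi.
- by move=> e; rewrite (linear_0 Tanti_linear); case: (qdeg_subspace e).
- by move=> e y z hy hz; rewrite (linear_D _ _ Tanti_linear); case: (qdeg_subspace e) => _ + _; apply.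
- by move=> e c y hy; rewrite (linear_Z _ _ Tanti_linear); case: (qdeg_subspace e) => _ _; apply.
Qed.

Lemma quo_graded : is_graded_hopf_algebra Delta eps anti qdeg.
Proof.
split; [exact: quo_hopf|exact: quo_grading|exact: qdeg1|exact: qdegM|exact: qdeg_comul|
  exact: qdeg_counit|exact: qdeg_antipode].
Qed.

Lemma qdeg0_grouplike x : qdeg 0 x -> span (grouplike Delta eps) x.
Proof.
move=> [y dy <-]; elim: dy => {y} [_ [u u0 ->]||y z _ hy _ hz|c y _ hy].
- apply: span_gen; elim: u u0 => [_|[] u IH //= u0].
    by rewrite -fword1 rmorph1; split; [exact: Delta1 | exact: eps1].
  rewrite -cat1s -fwordM rmorphM; have [Du eu] := IH u0; split.
    by rewrite Delta_gM Du tpureM.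
  by rewrite eps_gM.
- by rewrite raddf0; exact: span0.
- by rewrite raddfD; apply: spanD.
- by rewrite (linear_Z _ _ quo_linear); apply: spanZ.
Qed.

Lemma quo_pointed : pointed Delta eps.
Proof.
have G := quo_grading; apply: (pointed_of_deg0_grouplike quo_coalgebra (deg := qdeg)).
- exact: qdeg_subspace.
- exact: grading_sum G.
- exact: qdeg_comul.
- exact: qdeg0_grouplike.
Qed.

Theorem presentation_graded_pointed_hopf :
  exists (Delta : H -> (H ⊗ H)%type) (eps : H -> K) (S : H -> H),
    [/\ forall x : T, Delta (quo x) = tmap quo quo (TDelta x),
        forall x : T, eps (quo x) = Teps K x,
        is_graded_hopf_algebra Delta eps S qdeg
      & pointed Delta eps].
Proof.
exists Delta, eps, anti; split; [exact: Delta_quo | exact: eps_quo | | ].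
- exact: quo_graded.
- exact: quo_pointed.
Qed.

End Presentation.

(** * The iterated quotient as a presented algebra *)

Section IdealPullback.
Variables (K : fieldType) (A : algType K) (S : set A) (properS : ~ ideal S 1).
Local Notation pi := (api properS).

Lemma ideal_mono (S1 S2 : set A) x : (S1 `<=` S2)%classic -> ideal S1 x -> ideal S2 x.
Proof.
move=> sub; apply: (span_sub (span_subspace _)) => _ [a [s [b [Ss ->]]]].
by apply: span_gen; exists a, s, b; split=> //; apply: sub.
Qed.

Lemma ideal_pullback (S1 : set A) x : ideal [set pi y | y in S1]%classic (pi x) ->
  ideal (S `|` S1)%classic x.
Proof.
have lift y z : ideal (S `|` S1)%classic y -> pi y = pi z -> ideal (S `|` S1)%classic z.
  move=> Iy /esym/api_eq Sd; rewrite -[z](subrK y); apply: spanD => //.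
  by apply: ideal_mono Sd => s; left.
suff gen q : ideal [set pi y | y in S1]%classic q ->
    exists2 y, ideal (S `|` S1)%classic y & pi y = q.
  by case/gen => y; apply: lift.
elim=> {q} [_ [a [_ [b [[s Ss <-] ->]]]]||q r _ [y Iy <-] _ [z Iz <-]|c q _ [y Iy <-]].
- exists (arepr a * s * arepr b); last by rewrite !apiM !areprK.
  by apply: span_gen; exists (arepr a), s, (arepr b); split=> //; right.
- by exists 0; [exact: span0 | exact: raddf0].
- by exists (y + z); [exact: spanD | exact: raddfD].
- by exists (c *: y); [exact: spanZ | exact: apiZ].
Qed.

End IdealPullback.

Section Tbarnp.
Variables (K : fieldType) (n p : nat) (charK : p \in [pchar K]).

Definition proj_morph : {lrmorphism Tfree K -> Tbarnp n charK} :=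
  api (@Tbarnp_proper K n p charK) \o (@pi_np' K n p charK \o (pi_n K n \o pi_bar K)).

Lemma proj_morphE x : proj_morph x = proj n charK x.
Proof. by []. Qed.

Definition proj_sec (y : Tbarnp n charK) : Tfree K := arepr (arepr (arepr (arepr y))).

Lemma proj_secK : cancel proj_sec proj_morph.
Proof.
have bar z : pi_bar K (arepr z) = z by exact: areprK.
have barn z : pi_n K n (arepr z) = z by exact: areprK.
have barnp' z : @pi_np' K n p charK (arepr z) = z by exact: areprK.
by move=> y; rewrite proj_morphE /proj /proj_sec bar barn barnp' areprK.
Qed.

Lemma pi_barX m (x : Tfree K) : pi_bar K (x ^+ m) = pi_bar K x ^+ m.
Proof. exact: rmorphXn. Qed.

Lemma pi_nX m x : pi_n K n (x ^+ m) = pi_n K n x ^+ m.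
Proof. exact: rmorphXn. Qed.

Lemma pi_npX m x : @pi_np' K n p charK (x ^+ m) = @pi_np' K n p charK x ^+ m.
Proof. exact: rmorphXn. Qed.

Lemma pi_bar_rel : pi_bar K (Tg K ^+ n - 1) = pi_bar K (Tg K) ^+ n - 1.
Proof. by rewrite -pi_barX; exact: raddfB. Qed.

(** The four successive quotients collect the relations one after the other; the
    preimage of the ideal at each stage is computed by [ideal_pullback]. *)
Lemma proj_ker x : proj_morph x = 0 <-> ideal (@Trel K n p) x.
Proof.
split=> [x0|]; last first.
  apply: ideal_ker => r [rr|->|->|->].
  - have -> : proj_morph r = api (@Tbarnp_proper K n p charK)
        (@pi_np' K n p charK (pi_n K n 0)).
      congr (api _ (pi_np' _ _ (pi_n _ _ _))).
      by rewrite -(raddf0 (pi_bar K)); apply/api_eq; rewrite subr0; apply: ideal_gen.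
    by rewrite !raddf0.
  - have e : pi_n K n (pi_bar K (Tg K ^+ n - 1)) = 0.
      rewrite -(raddf0 (pi_n K n)); apply/api_eq; rewrite subr0; apply: ideal_gen.
      exact: pi_bar_rel.
    by rewrite /proj_morph /= e !raddf0.
  - have e : @pi_np' K n p charK (pi_n K n (pi_bar K (W p.-1))) = 0.
      rewrite -(raddf0 (@pi_np' K n p charK)); apply/api_eq; rewrite subr0.
      exact: ideal_gen.
    by rewrite /proj_morph /= e raddf0.
  - rewrite /proj_morph /= pi_barX pi_nX pi_npX.
    rewrite -(raddf0 (api (@Tbarnp_proper K n p charK))).
    by apply/api_eq; rewrite subr0; apply: ideal_gen.
(* Each S_i gathers the relations imposed after the i-th stage. *)
pose S3 : set (Tbarn K n) := [set pi_n K n (pi_bar K (Th K)) ^+ p]%classic.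
pose S2 : set (Tbar K) := [set pi_bar K (W p.-1); pi_bar K (Th K) ^+ p]%classic.
pose S1 : set (Tfree K) := [set r | [\/ r = Tg K ^+ n - 1, r = W p.-1 | r = Th K ^+ p]]%classic.
apply: (@ideal_mono K _ (@Tbar_rel K `|` S1)%classic).
  by move=> r [rr|[->|->|->]]; [constructor 1|constructor 2|constructor 3|constructor 4].
apply: (ideal_pullback (properS := @Tbar_proper K)).
apply: (@ideal_mono K _ (@Tbarn_rel K n `|` S2)%classic).
  move=> _ [->|[->|->]].
  - by exists (Tg K ^+ n - 1); [constructor 1 | exact: pi_bar_rel].
  - by exists (W p.-1) => //; constructor 2.
  - by exists (Th K ^+ p); [constructor 3 | exact: pi_barX].
apply: (ideal_pullback (properS := @Tbarn_proper K n)).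
apply: (@ideal_mono K _ (@Tbarnp'_rel K n p `|` S3)%classic).
  move=> _ [->|->].
  - by exists (pi_bar K (W p.-1)) => //; left.
  - by exists (pi_bar K (Th K) ^+ p); [right | exact: pi_nX].
apply: (ideal_pullback (properS := @Tbarnp'_proper K n p charK)).
apply: (@ideal_mono K _ (@Tbarnp_rel K n p charK)).
  by move=> _ ->; exists (pi_n K n (pi_bar K (Th K)) ^+ p) => //; exact: pi_npX.
move: x0; rewrite -(raddf0 (api (@Tbarnp_proper K n p charK))) => /api_eq.
by rewrite subr0.
Qed.

End Tbarnp.

Theorem proposition3p9 (K : fieldType) (p : nat) (charK : p \in [pchar K])
    (n : nat) (n_ge2 : (2 <= n)%N) (p_dvd_n : (p %| n)%N)
    (Egh_neq0 : Eomega K n 1 != 0) :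
  exists (Delta : Tbarnp n charK -> (Tbarnp n charK ⊗ Tbarnp n charK)%type)
         (eps : Tbarnp n charK -> K)
         (S : Tbarnp n charK -> Tbarnp n charK),
    [/\ forall x : Tfree K,
          Delta (proj n charK x) =
            tmap (proj n charK) (proj n charK) (TDelta x),
        forall x : Tfree K, eps (proj n charK x) = Teps K x,
        is_graded_hopf_algebra Delta eps S (Tbarnp_deg n charK)
      & pointed Delta eps].
Proof.
have [Delta [eps [S [DE eE gr pt]]]] := presentation_graded_pointed_hopf charK
  (ltnW n_ge2) (@proj_secK K n p charK) (@proj_ker K n p charK).
by exists Delta, eps, S.
Qed.
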